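(* For two conditions $\mathrm{C}$ and $\mathrm{C}'$ from the list IND, PWI, NOP, ER, KS, D, SUB, B, IO defined in the context, say that $\mathrm{C}$ implies $\mathrm{C}'$ if for every probability space $(\Omega,\mathcal F,P)$ and every sequence $A_1,A_2,\ldots\in\mathcal F$ with $\sum_{n=1}^\infty P(A_n)=\infty$, whenever the sequence satisfies $\mathrm{C}$ it also satisfies $\mathrm{C}'$. Then the following implications hold: (1) ER and KS are equivalent (each implies the other); (2) B and IO are equivalent (each implies the other); (3) IND implies PWI; PWI implies NOP; NOP implies ER; NOP implies D; ER implies SUB; D implies SUB; SUB implies IO. Moreover, these are all the implications between the nine conditions: $\mathrm{C}$ implies $\mathrm{C}'$ if and only if this follows from (1)--(3) by reflexivity and transitivity. In particular, PWI does not imply IND, NOP does not imply PWI, ER does not imply D, D does not imply ER, and IO does not imply SUB.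
   Context: Let $(\Omega,\mathcal F,P)$ be a probability space and $A_1,A_2,\ldots$ a sequence of events in $\mathcal F$ with $\sum_{n=1}^\infty P(A_n)=\infty$. Let $I_n=\mathbb 1_{A_n}$ be the indicator variable of $A_n$, $S_n=\sum_{i=1}^n I_i$, $\mu_n=E[S_n]$, and $X_n=S_n/\mu_n$ if $\mu_n\neq 0$, $X_n=1$ if $\mu_n=0$. For $m\le n$ let $E_m^n=\bigcup_{i=m}^n A_i$. $\overline{A}$ denotes the complement of $A$. Convention: if $P(E_m^i)=1$, then the conditional probability $P(E_m^{i+1}\mid\overline{E_m^i})$ is defined to be $1$. The conditions on the sequence $(A_n)$ are: - IND: there is a positive integer $N$ such that the events $A_n$, $n\ge N$, are (mutually) independent. - PWI: there is a positive integer $N$ such that the events $A_n$, $n\ge N$, are pairwise independent. - NOP: there is a positive integer $N$ such that $\mathrm{Cov}(I_i,I_j)\le 0$ for all $i,j\ge N$ with $i\ne j$. - ER: $\liminf_{n\to\infty}E[X_n^2]=1$. - KS: $\limsup_{n\to\infty}E[S_n]^2/E[S_n^2]=1$ (the quotient is defined for all but finitely many $n$). - D: $X_n\to 1$ almost surely. - SUB: there is a subsequence $X_{n_k}$ of $X_n$ (with $n_1<n_2<\cdots$) such that $X_{n_k}\to 1$ in probability (equivalently, in distribution). - B: for every positive integer $m$, $\sum_{i=m}^\infty P(E_m^{i+1}\mid\overline{E_m^i})=\infty$. - IO: almost surely infinitely many of the events $A_i$ occur, i.e. $P\left(\bigcap_{m=1}^\infty\bigcup_{i=m}^\infty A_i\right)=1$.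 *)

(* Defs.v *)
From HB Require Import structures.
From Stdlib Require Import Relation_Operators.
From mathcomp Require Import all_boot all_order all_algebra.
From mathcomp Require Import finmap.
From mathcomp Require Import all_classical all_reals all_analysis.

Set Implicit Arguments.
Unset Strict Implicit.
Unset Printing Implicit Defensive.

Import Order.TTheory GRing.Theory Num.Theory.
Import numFieldNormedType.Exports.

Local Open Scope classical_set_scope.
Local Open Scope ring_scope.

(* Sequences indexed by the positive integers are encoded with a shift by one:
   index [n : nat] stands for [n + 1].  Thus [A n] is the event A_{n+1}, and
   [Ssum A n], [Smean P A n], [Xratio P A n] are S_{n+1}, mu_{n+1}, X_{n+1}. *)

Definition Ssum d (T : measurableType d) (R : realType)
    (A : nat -> set T) (n : nat) : T -> R :=
  fun w => \sum_(i < n.+1) \1_(A i) w.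

(* [fine] only forgets that the expectation is extended-real valued: all the
   random variables below are bounded when the events are measurable. *)
Definition Smean d (T : measurableType d) (R : realType) (P : probability T R)
    (A : nat -> set T) (n : nat) : R :=
  fine 'E_P[Ssum R A n].

Definition Xratio d (T : measurableType d) (R : realType) (P : probability T R)
    (A : nat -> set T) (n : nat) : T -> R :=
  fun w => if Smean P A n == 0 then 1 else Ssum R A n w / Smean P A n.

Definition Eunion d (T : measurableType d) (A : nat -> set T) (m n : nat) :
    set T :=
  \bigcup_(i in [set i | (m <= i <= n)%N]) A i.

Definition cond_prob d (T : measurableType d) (R : realType)
    (P : probability T R) (F G : set T) : \bar R :=
  (fine (P (F `&` G)) / fine (P G))%:E.

(* P(E_m^{i+1} | complement of E_m^i), equal to 1 when P(E_m^i) = 1 *)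
Definition cond_next d (T : measurableType d) (R : realType)
    (P : probability T R) (A : nat -> set T) (m i : nat) : \bar R :=
  if P (Eunion A m i) == 1%E then 1%E
  else cond_prob P (Eunion A m i.+1) (~` Eunion A m i).

Definition cond_IND d (T : measurableType d) (R : realType)
    (P : probability T R) (A : nat -> set T) : Prop :=
  exists N : nat, forall J : {fset nat}, (forall j, j \in J -> (N <= j)%N) ->
    P (\bigcap_(j in [set` J]) A j) = (\prod_(j <- J) P (A j))%E.

Definition cond_PWI d (T : measurableType d) (R : realType)
    (P : probability T R) (A : nat -> set T) : Prop :=
  exists N : nat, forall i j : nat, (N <= i)%N -> (N <= j)%N -> i != j ->
    P (A i `&` A j) = (P (A i) * P (A j))%E.

Definition cond_NOP d (T : measurableType d) (R : realType)
    (P : probability T R) (A : nat -> set T) : Prop :=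
  exists N : nat, forall i j : nat, (N <= i)%N -> (N <= j)%N -> i != j ->
    (covariance P (\1_(A i)) (\1_(A j)) <= 0)%E.

Definition cond_ER d (T : measurableType d) (R : realType)
    (P : probability T R) (A : nat -> set T) : Prop :=
  limn_einf (fun n => 'E_P[(fun w => Xratio P A n w ^+ 2)%R]%E) = 1%E.

(* For the finitely many [n] with E[S_n^2] = 0 the quotient is 0, which does
   not affect the limsup. *)
Definition cond_KS d (T : measurableType d) (R : realType)
    (P : probability T R) (A : nat -> set T) : Prop :=
  limn_esup (fun n =>
    (Smean P A n ^+ 2 / fine 'E_P[(fun w => Ssum R A n w ^+ 2)%R])%:E) = 1%E.

Definition cond_D d (T : measurableType d) (R : realType)
    (P : probability T R) (A : nat -> set T) : Prop :=
  {ae P, forall w, Xratio P A n w @[n --> \oo] --> (1 : R)}.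

Definition cvg_in_prob d (T : measurableType d) (R : realType)
    (P : probability T R) (Y : nat -> T -> R) (c : R) : Prop :=
  forall e : R, 0 < e ->
    P [set w | e <= `|Y n w - c|] @[n --> \oo] --> (0%E : \bar R).

Definition cond_SUB d (T : measurableType d) (R : realType)
    (P : probability T R) (A : nat -> set T) : Prop :=
  exists phi : nat -> nat, (forall k, (phi k < phi k.+1)%N) /\
    cvg_in_prob P (fun k => Xratio P A (phi k)) 1.

Definition cond_B d (T : measurableType d) (R : realType)
    (P : probability T R) (A : nat -> set T) : Prop :=
  forall m : nat, (\sum_(m <= i <oo) cond_next P A m i = +oo)%E.

Definition cond_IO d (T : measurableType d) (R : realType)
    (P : probability T R) (A : nat -> set T) : Prop :=
  P (\bigcap_m \bigcup_(i >= m) A i) = 1%E.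

Inductive condition : Set := IND | PWI | NOP | ER | KS | D | SUB | B | IO.

Definition satisfies (C : condition) d (T : measurableType d) (R : realType)
    (P : probability T R) (A : nat -> set T) : Prop :=
  match C with
  | IND => cond_IND P A
  | PWI => cond_PWI P A
  | NOP => cond_NOP P A
  | ER => cond_ER P A
  | KS => cond_KS P A
  | D => cond_D P A
  | SUB => cond_SUB P A
  | B => cond_B P A
  | IO => cond_IO P A
  end.

Definition cond_implies (R : realType) (C C' : condition) : Prop :=
  forall (d : measure_display) (T : measurableType d) (P : probability T R)
    (A : nat -> set T),
    (forall n, measurable (A n)) ->
    (\sum_(0 <= n <oo) P (A n) = +oo)%E ->
    satisfies C P A -> satisfies C' P A.

Inductive basic_implication : condition -> condition -> Prop :=
  | ER_KS : basic_implication ER KS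
  | KS_ER : basic_implication KS ER
  | B_IO : basic_implication B IO
  | IO_B : basic_implication IO B
  | IND_PWI : basic_implication IND PWI
  | PWI_NOP : basic_implication PWI NOP
  | NOP_ER : basic_implication NOP ER
  | NOP_D : basic_implication NOP D
  | ER_SUB : basic_implication ER SUB
  | D_SUB : basic_implication D SUB
  | SUB_IO : basic_implication SUB IO.

Definition derivable_implication : condition -> condition -> Prop :=
  clos_refl_trans condition basic_implication.

(* Main.v *)
From HB Require Import structures.
From Stdlib Require Import Relation_Operators.
From mathcomp Require Import all_boot all_order all_algebra finmap.
From mathcomp Require Import ring lra zify.
From mathcomp Require Import all_classical all_reals all_analysis.
From mathcomp Require Import measurable_realfun.
Require Import Defs.
From mathcomp Require Import reals.

Set Implicit Arguments.
Unset Strict Implicit.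
Unset Printing Implicit Defensive.

Import Order.TTheory GRing.Theory Num.Theory.
Import numFieldNormedType.Exports.

Local Open Scope classical_set_scope.
Local Open Scope ring_scope.

(** The implications rest on the first two moments of [S_n], written as the
    finite sums [smean] and [smom2].  Both ER and KS say that
    [Var S_n <= e * mu_n ^+ 2] happens for arbitrarily large [n], whatever
    [e > 0] ([ER_smom2], [KS_smom2]); Chebyshev's inequality then extracts a
    subsequence converging in probability ([cond_ER_SUB]).  Under NOP, only
    boundedly many rows and columns of the covariance matrix can contribute
    positively off the diagonal, so [Var S_n <= C * mu_n] ([NOP_smom2]).  This
    gives ER at once, and D by the classical scheme: Chebyshev and
    Borel-Cantelli along times at which [mu_n] is about [k ^+ 4], then
    monotonicity of [S_n] in between ([linear_variance_D]).  If IO fails, then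
    [S_n] is bounded, and [X_n] tends to [0], on an event of positive
    probability, which SUB forbids ([cond_SUB_IO]).  Finally, the probability
    [q n] that none of the events of indices [m] to [n] occurs satisfies
    [q n.+1 = q n * (1 - p n)], where [p n] is the conditional probability in
    B; so [q n] tends to [0] exactly when the series of the [p n] diverges
    ([cond_B_IO], [cond_IO_B]).

    Five counterexamples show that nothing else holds.  Four of them live on
    the natural numbers with the geometric law [geometric_law]:
    - [NOP_not_PWI]: complements of disjoint events;
    - [IO_not_SUB]: the sure event and a fixed event of probability 1/2 in
      alternation;
    - [ER_not_D]: a fixed event and its complement in alternating blocks of
      doubling length, so that [S_n] is constant at the end of each pair of
      blocks but far from its mean in the middle;
    - [D_not_ER]: rare sure events drive [S_n], and long runs of equal events of
      small summable probability inflate only the second moment.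

    The last one, [PWI_not_IND], lives on the square of that space and uses
    pairwise independent events no three of which occur together.  Every other
    nonderivable implication would yield one of these five by transitivity
    ([implies_derivable]). *)

(** * Probabilities and moments as real numbers *)

(** Real-valued probabilities, on which linear arithmetic applies. *)
Definition pr d (T : measurableType d) (R : realType) (P : probability T R)
  (F : set T) : R := fine (P F).

Definition smean d (T : measurableType d) (R : realType) (P : probability T R)
  (A : nat -> set T) (n : nat) : R := \sum_(i < n.+1) pr P (A i).

Definition smom2 d (T : measurableType d) (R : realType) (P : probability T R)
    (A : nat -> set T) (n : nat) : R :=
  \sum_(i < n.+1) \sum_(j < n.+1) pr P (A i `&` A j).

Section RealProbabilities.
Context d (T : measurableType d) (R : realType) (P : probability T R).
Implicit Types F G : set T.

Lemma prE F : measurable F -> P F = (pr P F)%:E.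
Proof. by move=> mF; rewrite fineK// fin_num_measure. Qed.

Lemma pr_ge0 F : 0 <= pr P F.
Proof. by rewrite fine_ge0. Qed.

Lemma pr_le1 F : measurable F -> pr P F <= 1.
Proof. by move=> mF; rewrite -lee_fin -prE// probability_le1. Qed.

Lemma pr_setT : pr P setT = 1.
Proof. by rewrite /pr probability_setT. Qed.

Lemma le_pr F G : measurable F -> measurable G -> F `<=` G -> pr P F <= pr P G.
Proof.
by move=> mF mG FG; rewrite -lee_fin -!prE//; apply: le_measure; rewrite ?inE.
Qed.

Lemma pr_setU F G : measurable F -> measurable G -> F `&` G = set0 ->
  pr P (F `|` G) = pr P F + pr P G.
Proof.
move=> mF mG FG; apply: EFin_inj; rewrite EFinD -!prE//; last exact: measurableU.
by rewrite measureU//; apply/eqP.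
Qed.

Lemma pr_setID F G : measurable F -> measurable G ->
  pr P F = pr P (F `&` G) + pr P (F `&` ~` G).
Proof.
move=> mF mG; rewrite -pr_setU.
- by rewrite -setIUr setUv setIT.
- exact: measurableI.
- by apply: measurableI => //; exact: measurableC.
- by rewrite setIACA setICr setI0.
Qed.

Lemma pr_setC F : measurable F -> pr P (~` F) = 1 - pr P F.
Proof.
move=> mF; have := pr_setID measurableT mF.
by rewrite !setTI pr_setT => ->; rewrite addrAC subrr add0r.
Qed.

Lemma indic_Lfun1 F : measurable F -> (\1_F : T -> R) \in Lfun P 1.
Proof. by move=> mF; apply/Lfun1_integrable; exact: integrable_indic. Qed.

Lemma Lfun1_measurable (f : T -> R) : f \in Lfun P 1 -> measurable_fun setT f.
Proof. by move=> /Lfun1_integrable/measurable_int/measurable_EFinP. Qed.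

Lemma sum_Lfun1 (I : Type) (r : seq I) (f : I -> T -> R) :
  (forall i, f i \in Lfun P 1) -> (fun w => \sum_(i <- r) f i w) \in Lfun P 1.
Proof.
move=> Lf; rewrite (_ : (fun _ => _) = \sum_(i <- r) f i).
  by apply: rpred_sum => i _.
by apply/funext => w; rewrite fct_sumE.
Qed.

Lemma expectation_sum_fun (I : Type) (r : seq I) (f : I -> T -> R) :
  (forall i, f i \in Lfun P 1) ->
  ('E_P[(fun w => \sum_(i <- r) f i w)%R] = \sum_(i <- r) 'E_P[f i])%E.
Proof.
move=> Lf; elim: r => [|i r IHr].
  rewrite big_nil -[RHS](expectation_cst P 0); congr expectation.
  by apply/funext => w; rewrite big_nil.
rewrite big_cons -IHr -expectationD//; last exact: sum_Lfun1.
by congr expectation; apply/funext => w; rewrite big_cons.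
Qed.

Lemma covariance_indic F G : measurable F -> measurable G ->
  covariance P (\1_F) (\1_G) = (pr P (F `&` G) - pr P F * pr P G)%:E.
Proof.
move=> mF mG; have FG : (\1_F * \1_G = \1_(F `&` G) :> (T -> R))%R.
  by rewrite indicI; apply/funext.
rewrite covarianceE ?FG; try by apply: indic_Lfun1 => //; exact: measurableI.
by rewrite !expectation_indic ?prE//; exact: measurableI.
Qed.

End RealProbabilities.

Section Moments.
Context d (T : measurableType d) (R : realType) (P : probability T R).
Variables (A : nat -> set T) (mA : forall n, measurable (A n)).

Let mAI i j : measurable (A i `&` A j).
Proof. exact: measurableI. Qed.

Lemma Ssum_ge0 n w : 0 <= Ssum R A n w.
Proof. by apply: sumr_ge0 => i _; rewrite indicE. Qed.

Lemma le_Ssum m n w : (m <= n)%N -> Ssum R A m w <= Ssum R A n w.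
Proof.
move=> mn; rewrite /Ssum -!(big_mkord xpredT (fun i => \1_(A i) w)).
rewrite [leRHS](big_cat_nat _ (n := m.+1))//= lerDl.
by apply: sumr_ge0 => i _; rewrite indicE.
Qed.

Lemma Ssum_Lfun1 n : Ssum R A n \in Lfun P 1.
Proof. by apply: sum_Lfun1 => i; exact: indic_Lfun1. Qed.

Lemma measurable_Ssum n : measurable_fun setT (Ssum R A n).
Proof. exact: Lfun1_measurable (Ssum_Lfun1 n). Qed.

Lemma expectation_Ssum n : ('E_P[Ssum R A n] = (smean P A n)%:E)%E.
Proof.
rewrite expectation_sum_fun; last by move=> i; exact: indic_Lfun1.
rewrite /smean -sumEFin; apply: eq_bigr => i _.
by rewrite expectation_indic ?prE.
Qed.

Lemma SmeanE n : Smean P A n = smean P A n.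
Proof. by rewrite /Smean expectation_Ssum. Qed.

Let sqr_Ssum n : (fun w => Ssum R A n w ^+ 2) =
  (fun w => \sum_(i < n.+1) \sum_(j < n.+1) \1_(A i `&` A j) w) :> (T -> R).
Proof.
apply/funext => w; rewrite expr2 /Ssum mulr_suml; apply: eq_bigr => i _.
by rewrite mulr_sumr; apply: eq_bigr => j _; rewrite indicI.
Qed.

Lemma sqr_Ssum_Lfun1 n : (fun w => Ssum R A n w ^+ 2) \in Lfun P 1.
Proof.
by rewrite sqr_Ssum; do 2!apply: sum_Lfun1 => ?; exact: indic_Lfun1.
Qed.

Lemma expectation_sqr_Ssum n :
  ('E_P[(fun w => Ssum R A n w ^+ 2)%R] = (smom2 P A n)%:E)%E.
Proof.
rewrite sqr_Ssum expectation_sum_fun; last first.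
  by move=> i; apply: sum_Lfun1 => j; exact: indic_Lfun1.
rewrite -sumEFin; apply: eq_bigr => i _.
rewrite expectation_sum_fun; last by move=> j; exact: indic_Lfun1.
by rewrite -sumEFin; apply: eq_bigr => j _; rewrite expectation_indic ?prE.
Qed.

Lemma smean_ge0 n : 0 <= smean P A n.
Proof. by apply: sumr_ge0 => i _; exact: pr_ge0. Qed.

Lemma smeanS n : smean P A n.+1 = smean P A n + pr P (A n.+1).
Proof. by rewrite /smean big_ord_recr. Qed.

Lemma le_smean m n : (m <= n)%N -> smean P A m <= smean P A n.
Proof.
move=> /subnK <-; elim: (n - m)%N => [|k IHk]; first by rewrite add0n.
by apply: (le_trans IHk); rewrite addSn smeanS lerDl pr_ge0.
Qed.

Lemma smeanS_le n : smean P A n.+1 <= smean P A n + 1.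
Proof. by rewrite smeanS lerD2l pr_le1. Qed.

(** Integrating the pointwise inequality
    [e ^+ 2 * \1_F + 2 * mu * S <= S ^+ 2 + mu ^+ 2], in which all functions are
    nonnegative, gives Chebyshev's inequality in terms of the two moments.
    The case [e = 0] is [mu ^+ 2 <= smom2]. *)
Lemma chebyshev_smom2 n (e : R) : 0 <= e ->
  e ^+ 2 * pr P [set w | e <= `|Ssum R A n w - smean P A n|]
    + smean P A n ^+ 2 <= smom2 P A n.
Proof.
move=> e0; set F := [set _ | _]; set mu := smean P A n.
have mF : measurable F.
  rewrite -[F]setTI; apply: measurable_fun_le => //.
  apply: measurableT_comp => //; apply: measurable_funB => //.
  exact: measurable_Ssum.
have L1 : (e ^+ 2 \o* \1_F : T -> R) \in Lfun P 1.
  by apply: Lfun_scale => //; exact: indic_Lfun1.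
have L2 : (mu *+ 2 \o* Ssum R A n : T -> R) \in Lfun P 1.
  by apply: Lfun_scale => //; exact: Ssum_Lfun1.
have L3 : (cst (mu ^+ 2) : T -> R) \in Lfun P 1 by exact: Lfun_cst.
have h : ('E_P[((e ^+ 2 \o* \1_F) \+ (mu *+ 2 \o* Ssum R A n))%R]
   <= 'E_P[((fun w => Ssum R A n w ^+ 2) \+ cst (mu ^+ 2))%R])%E.
  apply: expectation_le.
  - apply: measurable_funD; first exact: Lfun1_measurable L1.
    exact: Lfun1_measurable L2.
  - by apply: measurable_funD => //; exact: Lfun1_measurable (sqr_Ssum_Lfun1 n).
  - move=> w /=; rewrite addr_ge0// mulr_ge0 ?sqr_ge0 ?Ssum_ge0 ?indicE//.
    by rewrite mulrn_wge0// smean_ge0.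
  - by move=> w /=; rewrite addr_ge0// sqr_ge0.
  - apply: aeW => w /=.
    have -> : Ssum R A n w ^+ 2 + mu ^+ 2 =
        (Ssum R A n w - mu) ^+ 2 + Ssum R A n w * (mu *+ 2) by lra.
    rewrite lerD2r indicE; have [|_] := boolP (w \in F).
      rewrite inE /F/= mul1r => eS.
      by rewrite -[leRHS]real_normK ?num_real// ler_pXn2r ?nnegrE.
    by rewrite mul0r sqr_ge0.
move: h; rewrite !expectationD ?sqr_Ssum_Lfun1//.
rewrite expectation_cst !expectationZl ?Ssum_Lfun1 ?indic_Lfun1//.
rewrite expectation_Ssum expectation_sqr_Ssum.
rewrite expectation_indic// prE// -!EFinM -!EFinD lee_fin -/mu.
lra.
Qed.

Lemma sqr_smean_le n : smean P A n ^+ 2 <= smom2 P A n.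
Proof. by have := @chebyshev_smom2 n 0 (lexx _); rewrite expr0n mul0r add0r. Qed.

Lemma Xratio_neq0 n : smean P A n != 0 ->
  Xratio P A n = (fun w => Ssum R A n w / smean P A n).
Proof. by move=> mu0; apply/funext => w; rewrite /Xratio SmeanE (negbTE mu0). Qed.

Lemma measurable_Xratio n : measurable_fun setT (Xratio P A n).
Proof.
rewrite /Xratio; case: (Smean P A n == 0); first exact: measurable_cst.
by apply: measurable_funM => //; exact: measurable_Ssum.
Qed.

Lemma measurable_dev n (e : R) : measurable [set w | e <= `|Xratio P A n w - 1|].
Proof.
rewrite -[X in measurable X]setTI; apply: measurable_fun_le => //.
apply: measurableT_comp => //; apply: measurable_funB => //.
exact: measurable_Xratio.
Qed.

Lemma chebyshev_Xratio n (e : R) : 0 < e -> 0 < smean P A n ->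
  pr P [set w | e <= `|Xratio P A n w - 1|]
    <= (smom2 P A n - smean P A n ^+ 2) / (e * smean P A n) ^+ 2.
Proof.
move=> e0 mu0; rewrite ler_pdivlMr; last by rewrite exprn_gt0// mulr_gt0.
rewrite lerBrDr mulrC (_ : [set _ | _] =
  [set w | e * smean P A n <= `|Ssum R A n w - smean P A n|]).
  by apply: chebyshev_smom2; rewrite ltW// mulr_gt0.
apply/funext => w; apply/propext => /=; rewrite Xratio_neq0 ?gt_eqF//.
have -> : Ssum R A n w / smean P A n - 1
      = (Ssum R A n w - smean P A n) / smean P A n by rewrite mulrBl divff ?gt_eqF.
by rewrite normrM normfV (gtr0_norm mu0) ler_pdivlMr.
Qed.

Lemma IO_tails : cond_IO P A <->
  forall m, pr P (~` \bigcup_(i >= m) A i) = 0.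
Proof.
have mU m : measurable (~` \bigcup_(i >= m) A i).
  by apply: measurableC; exact: bigcup_measurable.
have mI : measurable (\bigcap_m \bigcup_(i >= m) A i).
  by apply: bigcapT_measurable => m; exact: bigcup_measurable.
have -> : cond_IO P A <-> pr P (~` \bigcap_m \bigcup_(i >= m) A i) = 0.
  rewrite /cond_IO pr_setC// (prE P mI); split=> [[->]|/eqP]; first by rewrite subrr.
  by rewrite subr_eq0 => /eqP <-.
split=> [io m|U0].
  apply/eqP; rewrite eq_le pr_ge0 andbT -[leRHS]io; apply: le_pr => //.
    exact: measurableC.
  by apply: subsetC => w; exact.
rewrite setC_bigcap /pr.
suff -> : P (\bigcup_m ~` \bigcup_(i >= m) A i) = 0%E by [].
apply: measure_negligible; first exact: bigcup_measurable.
apply: negligible_bigcup => m.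
have PU0 : P (~` \bigcup_(i >= m) A i) = 0%E by rewrite (prE P (mU m)) U0.
by apply/negligibleP => //; exact: PU0.
Qed.

End Moments.

(** * Second moments, convergence in probability and IO *)

Lemma sum_ltn_le (R : realType) (m n : nat) :
  \sum_(i < n) (i < m)%N%:R <= m%:R :> R.
Proof.
suff -> : \sum_(i < n) (i < m)%N%:R = (minn n m)%:R :> R.
  by rewrite ler_nat geq_minr.
elim: n => [|n IHn]; first by rewrite big_ord0 min0n.
by rewrite big_ord_recr/= IHn -natrD; congr _%:R; case: ltnP => ?; lia.
Qed.

(** The infimum of each tail is at least [c], and it is exactly [c] if and only
    if the sequence comes within every [e] of [c] beyond every index. *)
Lemma limn_einf_lbound (R : realType) (u : (\bar R)^nat) (c : R) :
  (forall n, c%:E <= u n)%E ->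
  limn_einf u = c%:E <->
  (forall e, 0 < e -> forall N, exists2 n, (N <= n)%N & (u n <= (c + e)%:E)%E).
Proof.
move=> uc; rewrite limn_einf_lim; split.
  move=> lim_c e e0 N.
  have : (einfs u N < (c + e)%:E)%E.
    apply: (@le_lt_trans _ _ c%:E); last by rewrite lte_fin ltrDl.
    rewrite -lim_c (cvg_lim _ (@cvg_einfs_sup _ u))//.
    by apply: ereal_sup_ubound; exists N.
  by move=> /ereal_inf_lt[_ [n /= Nn <-] /ltW un]; exists n.
move=> freq; have -> : einfs u = fun=> c%:E; last first.
  by apply/cvg_lim => //; exact: cvg_cst.
apply/funext => N; apply/eqP; rewrite eq_le; apply/andP; split.
  apply/lee_addgt0Pr => e e0; have [n Nn un] := freq e e0 N.
  by apply: le_trans un; apply: ereal_inf_lbound; exists n.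
by apply: le_ereal_inf_tmp => _ [n _ <-]; exact: uc.
Qed.

(** The common form of ER and KS: both normalized quantities are on one side
    of [1] for every [n], so a limit point at [1] means that the variance is
    negligible before [mu ^+ 2] for arbitrarily large [n]. *)
Definition freq_small_variance d (T : measurableType d) (R : realType)
    (P : probability T R) (A : nat -> set T) : Prop :=
  forall e, 0 < e -> forall N, exists2 n, (N <= n)%N &
    smom2 P A n <= (1 + e) * smean P A n ^+ 2.

Section Implications.
Context d (T : measurableType d) (R : realType) (P : probability T R).
Variables (A : nat -> set T) (mA : forall n, measurable (A n)).
Hypothesis sumA : (\sum_(0 <= n <oo) P (A n) = +oo)%E.

Lemma smean_unbounded (M : R) : exists N, forall n, (N <= n)%N -> M <= smean P A n.
Proof.
suff [N MN] : exists N, M <= smean P A N.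
  by exists N => n Nn; apply: (le_trans MN); exact: le_smean.
apply: contrapT => bnd.
have : (\sum_(0 <= n <oo) P (A n) <= M%:E)%E.
  apply: lime_le; first by apply: is_cvg_nneseries => *; exact: measure_ge0.
  near=> n; have n0 : (0 < n)%N by near: n; exists 1%N.
  rewrite big_mkord -(prednK n0); under eq_bigr do rewrite prE//.
  rewrite sumEFin lee_fin leNgt; apply/negP => /ltW ?; apply: bnd.
  by exists n.-1.
by rewrite sumA leye_eq.
Unshelve. all: by end_near. Qed.

Lemma smean_gt0 : exists N, forall n, (N <= n)%N -> 0 < smean P A n.
Proof.
have [N N1] := smean_unbounded 1; exists N => n /N1.
exact: lt_le_trans.
Qed.

Lemma ER_smom2 : cond_ER P A <-> freq_small_variance P A.
Proof.
have uE n : smean P A n != 0 -> 'E_P[(fun w => Xratio P A n w ^+ 2)%R]%E =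
    (smom2 P A n / smean P A n ^+ 2)%:E.
  move=> mu0; rewrite Xratio_neq0// mulrC EFinM -expectation_sqr_Ssum//.
  rewrite -expectationZl ?sqr_Ssum_Lfun1//; congr expectation.
  by apply/funext => w /=; rewrite exprMn exprVn mulrC.
rewrite /cond_ER limn_einf_lbound; last first.
  move=> n; have [mu0|mu0] := eqVneq (smean P A n) 0.
    rewrite (_ : (fun _ => _)%R = cst 1%R) ?expectation_cst//.
    by apply/funext => w; rewrite /Xratio SmeanE// mu0 eqxx expr1n.
  rewrite uE// lee_fin ler_pdivlMr ?mul1r ?sqr_smean_le//.
  by rewrite exprn_even_gt0.
have [N0 mu0] := smean_gt0; split=> h e e0 N;
    have [n] := h e e0 (maxn N N0); rewrite geq_max => /andP[Nn N0n] hn;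
    have mun := mu0 _ N0n; exists n => //; move: hn.
  by rewrite uE ?gt_eqF// lee_fin ler_pdivrMr ?exprn_gt0.
by rewrite uE ?gt_eqF// lee_fin ler_pdivrMr ?exprn_gt0.
Qed.

Lemma KS_smom2 : cond_KS P A <-> freq_small_variance P A.
Proof.
have [N0 mu0] := smean_gt0.
have m20 n : (N0 <= n)%N -> 0 < smom2 P A n.
  move=> /mu0 mun; apply: lt_le_trans (sqr_smean_le P mA n); exact: exprn_gt0.
(* after a change of sign, the superior limit becomes an inferior limit
   bounded below by -1 *)
set v := fun n => - (smean P A n ^+ 2 / smom2 P A n).
have -> : cond_KS P A <-> limn_einf (EFin \o v) = (-1)%:E.
  rewrite (_ : EFin \o v = -%E \o (fun n => (Smean P A n ^+ 2
     / fine 'E_P[(fun w => Ssum R A n w ^+ 2)%R])%:E)); last first.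
    by apply/funext => n /=; rewrite SmeanE// expectation_sqr_Ssum.
  rewrite limn_einfN EFinN /cond_KS; split=> [->//|/eqP].
  by rewrite eqe_opp => /eqP.
rewrite limn_einf_lbound; last first.
  move=> n /=; rewrite lee_fin /v lerN2.
  have [->|m2n] := eqVneq (smom2 P A n) 0; first by rewrite invr0 mulr0.
  rewrite ler_pdivrMr ?mul1r ?sqr_smean_le//.
  by rewrite lt_neqAle eq_sym m2n (le_trans (sqr_ge0 _) (sqr_smean_le P mA n)).
split=> h e e0 N.
  have e1 : 0 < 1 + e by rewrite addr_gt0.
  (* 1 - e / (1 + e) is the inverse of 1 + e *)
  have [|n] := h (e / (1 + e)) _ (maxn N N0); first by rewrite divr_gt0.
  rewrite geq_max => /andP[Nn N0n]; rewrite /= lee_fin /v => hn; exists n => //.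
  have {}hn : (1 + e)^-1 <= smean P A n ^+ 2 / smom2 P A n.
    have -> : (1 + e)^-1 = 1 - e / (1 + e) by field; rewrite gt_eqF.
    lra.
  by move: hn; rewrite ler_pdivlMr ?m20// ler_pdivrMl.
have [n] := h e e0 (maxn N N0).
rewrite geq_max => /andP[Nn N0n] hn; exists n => //.
rewrite /= lee_fin /v lerNl opprD opprK ler_pdivlMr ?m20//.
have := m20 _ N0n; have := sqr_smean_le P mA n.
set a := smean P A n ^+ 2 in hn *; set b := smom2 P A n in hn *.
move=> ab b0; nra.
Qed.

(** With [Var S_n <= mu_n ^+ 2 / k.+1] at [n = phi k], Chebyshev's inequality
    bounds the probability of a deviation by [e] by [e ^- 2 / k.+1]. *)
Lemma cond_ER_SUB : cond_ER P A -> cond_SUB P A.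
Proof.
move=> /ER_smom2 fsv; have [N0 mu0] := smean_gt0.
have next k m : {n | (m < n)%N & 0 < smean P A n /\
    smom2 P A n - smean P A n ^+ 2 <= smean P A n ^+ 2 / k.+1%:R}.
  apply: cid2; have k0 : 0 < k.+1%:R^-1 :> R by rewrite invr_gt0 ltr0n.
  have [n] := fsv _ k0 (maxn m.+1 N0).
  rewrite geq_max => /andP[mn N0n] hn; exists n => //; split; first exact: mu0.
  rewrite lerBlDr; apply: (le_trans hn).
  by rewrite mulrDl mul1r addrC [X in X + _]mulrC.
pose phi := fix F k := if k is k'.+1 then s2val (next k (F k'))
  else s2val (next 0%N 0%N).
have phiS k : (phi k < phi k.+1)%N by exact: (s2valP (next k.+1 (phi k))).
have phiP k : 0 < smean P A (phi k) /\
    smom2 P A (phi k) - smean P A (phi k) ^+ 2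
      <= smean P A (phi k) ^+ 2 / k.+1%:R.
  by case: k => [|k] /=; exact: (s2valP' (next _ _)).
exists phi; split=> // e e0.
apply: (@squeeze_cvge _ _ _ _ (cst 0%E) _
    (fun k => (e ^- 2 * k.+1%:R^-1)%:E)).
- near=> k; rewrite measure_ge0/= prE; last exact: measurable_dev.
  have [mu_gt0 hk] := phiP k; rewrite lee_fin.
  apply: (le_trans (chebyshev_Xratio mA e0 mu_gt0)).
  rewrite ler_pdivrMr ?exprn_gt0 ?mulr_gt0//; apply: (le_trans hk).
  have e20 : e ^+ 2 != 0 by rewrite expf_neq0// gt_eqF.
  by rewrite exprMn mulrACA mulVf// mul1r mulrC.
- exact: cvg_cst.
- apply: cvg_EFin; first by near=> k.
  rewrite -(mulr0 (e ^- 2)); apply: cvgM; first exact: cvg_cst.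
  exact: cvg_harmonic.
Unshelve. all: by end_near. Qed.

(** A point where deviations by [e] occur infinitely often is not a point of
    convergence, so the superior limit of the deviation events is negligible;
    the probabilities of their tail unions decrease to its probability. *)
Lemma cond_D_SUB : cond_D P A -> cond_SUB P A.
Proof.
move=> cvgX; exists id; split=> // e e0.
pose F k := [set w | e <= `|Xratio P A k w - 1|].
have mF k : measurable (F k) by exact: measurable_dev.
have mlim : measurable (lim_sup_set F).
  apply: bigcapT_measurable => k; exact: bigcup_measurable.
have F0 : P (lim_sup_set F) = 0%E.
  apply/(@measure_negligible _ _ _ P) => //.
  apply: negligibleS cvgX => w Fw /= cvgw.
  move/cvgrPdist_lt : cvgw => /(_ _ e0)[n _ hn].
  have [k /= nk] := Fw n I; rewrite /F/= leNgt distrC => /negP; apply.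
  exact: hn.
have cvgU := @lim_sup_set_cvg _ _ _ P F mF _.
apply: (@squeeze_cvge _ _ _ _ (cst 0%E) _
   (fun n => P (\bigcup_(k in [set k | (n <= k)%N]) F k))).
- near=> k; rewrite measure_ge0/=; apply: le_measure; rewrite ?inE.
  + exact: mF.
  + by apply: bigcup_measurable => i _; exact: mF.
  + by move=> w Fw; exists k => /=.
- exact: cvg_cst.
- rewrite -F0; apply: cvgU; apply: (@le_lt_trans _ _ 1%E); last exact: ltry.
  by apply: probability_le1; exact: bigcup_measurable.
Unshelve. all: by end_near. Qed.

(** Outside [\bigcup_(i >= m) A i] at most [m] events occur, so [X_n <= 1/2] as
    soon as [mu_n >= 2 * m.+1]: this set lies in the deviation events of every
    large [n]. *)
Lemma cond_SUB_IO : cond_SUB P A -> cond_IO P A.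
Proof.
move=> [phi [phiS cvgX]].
have phi_ge k : (k <= phi k)%N.
  by elim: k => // k IHk; exact: leq_ltn_trans (phiS k).
apply/IO_tails => // m.
have mC : measurable (~` \bigcup_(i >= m) A i).
  by apply: measurableC; exact: bigcup_measurable.
suff PU : P (~` \bigcup_(i >= m) A i) = 0%E by rewrite /pr PU.
have [N hN] := smean_unbounded (2 * m.+1%:R).
have half0 : 0 < 2^-1 :> R by rewrite invr_gt0.
have lim0 := cvgX _ half0.
apply/eqP; rewrite eq_le measure_ge0 andbT.
rewrite -(cvg_lim (@ereal_hausdorff _) lim0); apply: lime_ge.
  by apply: cvgP lim0.
near=> k; apply: le_measure; rewrite ?inE//; first exact: measurable_dev.
move=> w /= Uw; have mun := hN (phi k) _.
have {}mun : 2 * m.+1%:R <= smean P A (phi k).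
  by apply: mun; apply: leq_trans (phi_ge k); near: k; exists N.
have mu0 : 0 < smean P A (phi k) by apply: lt_le_trans mun; rewrite mulr_gt0// ltr0n.
have Sm : Ssum R A (phi k) w <= m%:R.
  apply: le_trans (sum_ltn_le R m (phi k).+1); apply: ler_sum => i _.
  case: ltnP => [_|mi]; first by rewrite indicE; case: (_ \in _).
  by rewrite indicE memNset// => Aiw; apply: Uw; exists i.
rewrite Xratio_neq0 ?gt_eqF// ler0_norm.
  rewrite opprB lerBrDr addrC -lerBrDr ler_pdivrMr//.
  rewrite (_ : 1 - 2^-1 = 2^-1); last by lra.
  apply: (le_trans Sm); rewrite mulrC -ler_pdivrMr ?invr_gt0//.
  rewrite invrK; apply: le_trans mun; rewrite mulrC ler_pM2l// ler_nat.
  exact: leqnSn.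
rewrite subr_le0 ler_pdivrMr// mul1r (le_trans Sm)// (le_trans _ mun)//.
by rewrite -natrM ler_nat; lia.
Unshelve. all: by end_near. Qed.

End Implications.

(** * Conditional tail probabilities *)

Section ConditionB.
Context d (T : measurableType d) (R : realType) (P : probability T R).
Variables (A : nat -> set T) (mA : forall n, measurable (A n)).

Let q m n := pr P (~` Eunion A m n).

Let mE m n : measurable (Eunion A m n).
Proof. exact: bigcup_measurable. Qed.

Let mEC m n : measurable (~` Eunion A m n).
Proof. exact: measurableC. Qed.

Let le_Eunion m n p : (n <= p)%N -> Eunion A m n `<=` Eunion A m p.
Proof.
move=> np w [i /= /andP[mi ni] Aiw]; exists i => //=.
by rewrite mi (leq_trans ni).
Qed.

Let le_q m n p : (n <= p)%N -> q m p <= q m n.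
Proof. by move=> np; apply: le_pr => //; apply: subsetC; exact: le_Eunion. Qed.

Let q_ge0 m n : 0 <= q m n.
Proof. exact: pr_ge0. Qed.

Let cond_nextE m i :
  cond_next P A m i = (if q m i == 0 then 1 else 1 - q m i.+1 / q m i)%:E.
Proof.
have Pq : (P (Eunion A m i) == 1%E) = (q m i == 0).
  by rewrite prE// /q pr_setC// subr_eq0 eq_sym.
rewrite /cond_next Pq; case: ifPn => // q0; congr EFin.
have -> : fine (P (Eunion A m i.+1 `&` ~` Eunion A m i)) = q m i - q m i.+1.
  rewrite /q (pr_setID _ (mEC m i) (mE m i.+1)).
  rewrite [~` Eunion A m i `&` ~` _]setIidr; last first.
    by apply: subsetC; exact: le_Eunion.
  by rewrite addrK setIC.
by rewrite mulrBl divff.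
Qed.

Let cond_next_ge0 m i : (0 <= cond_next P A m i)%E.
Proof.
rewrite cond_nextE lee_fin; case: ifPn => // q0.
have qi : 0 < q m i by rewrite lt_neqAle eq_sym q0 q_ge0.
by rewrite subr_ge0 ler_pdivrMr// mul1r le_q.
Qed.

Lemma IO_tail0 : cond_IO P A <->
  forall m, q m n @[n --> \oo] --> 0.
Proof.
have capE m : \bigcap_n ~` Eunion A m n = ~` \bigcup_(i >= m) A i.
  apply/seteqP; split => w.
    move=> h [i /= mi Aiw]; apply: (h i I).
    by exists i => //=; rewrite mi leqnn.
  by move=> h n _ [i /= /andP[mi _] Aiw]; apply: h; exists i.
have cvgq m : q m n @[n --> \oo] --> pr P (~` \bigcup_(i >= m) A i).
  have mU : measurable (~` \bigcup_(i >= m) A i).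
    by apply: measurableC; exact: bigcup_measurable.
  have := @nonincreasing_cvg_mu _ _ _ P (fun n => ~` Eunion A m n).
  rewrite capE => h; apply: fine_cvg; rewrite -prE//.
  apply: h => //.
  - by rewrite (@le_lt_trans _ _ 1%E) ?ltry// probability_le1.
  - by move=> n p np; apply/subsetPset; apply: subsetC; exact: le_Eunion.
rewrite IO_tails//; split=> h m; first by rewrite -(h m).
by apply: (cvg_unique _ (cvgq m) (h m)); exact: norm_hausdorff.
Qed.

(** As [q] is nonincreasing, the sum of [(q i - q i.+1) / q i] over
    [n <= i < l] is at least [1 - q l / q n], hence at least [1/2] for [l]
    large.  If [q n = 0], the convention gives terms equal to [1]. *)
Lemma cond_IO_B : cond_IO P A -> cond_B P A.
Proof.
move=> /IO_tail0 q0 m.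
have grow M : exists2 n, (m <= n)%N &
    ((M%:R / 2)%:E <= \sum_(m <= i < n) cond_next P A m i)%E.
  elim: M => [|M [n mn IHM]].
    by exists m => //; rewrite big_geq// mul0r.
  have [l nl hl] : exists2 l, (n <= l)%N &
      ((2^-1)%:E <= \sum_(n <= i < l) cond_next P A m i)%E.
    have [qn0|qn0] := eqVneq (q m n) 0.
      exists n.+1 => //; rewrite big_nat1 cond_nextE qn0 eqxx lee_fin; lra.
    have qn : 0 < q m n by rewrite lt_neqAle eq_sym qn0 q_ge0.
    have qn2 : 0 < q m n / 2 by rewrite divr_gt0.
    have /cvgrPdist_lt/(_ _ qn2)[l0 _ hl0] := q0 m.
    exists (maxn l0 n); first exact: leq_maxr.
    set l := maxn l0 n.
    have hql : q m l < q m n / 2.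
      have := hl0 l (leq_maxl _ _); rewrite sub0r normrN ger0_norm ?q_ge0//.
    have key p : (n <= p)%N -> 
        ((1 - q m p / q m n)%:E <= \sum_(n <= i < p) cond_next P A m i)%E.
      move=> /subnKC <-; elim: (p - n)%N => [|k IHk].
        by rewrite addn0 big_geq// divff// subrr.
      rewrite addnS big_nat_recr ?leq_addr//=; set i := (n + k)%N in IHk *.
      have ni : (n <= i)%N by exact: leq_addr.
      apply: le_trans (leeD IHk (lexx _)); rewrite cond_nextE -EFinD lee_fin.
      have [qp0|qp0] := eqVneq (q m i) 0.
        by rewrite qp0 mul0r; have := divr_ge0 (q_ge0 m i.+1) (ltW qn); lra.
      have qp : 0 < q m i by rewrite lt_neqAle eq_sym qp0 q_ge0.
      have h : (q m i - q m i.+1) / q m n <= (q m i - q m i.+1) / q m i.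
        rewrite ler_wpM2l ?subr_ge0 ?le_q// lef_pV2 ?posrE//.
        exact: le_q.
      move: h; rewrite mulrBl (mulrBl (q m i)^-1) divff// ; lra.
    apply: le_trans (key l (leq_maxr _ _)); rewrite lee_fin.
    rewrite lerBrDr addrC -lerBrDr ler_pdivrMr//.
    rewrite (_ : 1 - 2^-1 = 2^-1); last by lra.
    by rewrite mulrC ltW.
  exists l; first exact: leq_trans nl.
  rewrite (big_cat_nat _ (n := n))//= -addn1 natrD mulrDl EFinD.
  by apply: leeD => //; rewrite mul1r.
apply: eq_infty => r.
have [n _ hn] := grow (Num.bound `|2 * r|).
apply: (@le_trans _ _ ((Num.bound `|2 * r|)%:R / 2)%:E).
  by rewrite lee_fin ler_pdivlMr// mulrC (le_trans (ler_norm _))// ltW// archi_boundP.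
by apply: (le_trans hn); apply: nneseries_lim_ge.
Qed.

(** Since [q i.+1 = q i * (1 - p i)], the quantity [q n * (1 + \sum_(i < n) p i)]
    is nonincreasing in [n], so [q n] is at most the inverse of a quantity
    that diverges. *)
Lemma cond_B_IO : cond_B P A -> cond_IO P A.
Proof.
move=> hB; apply/IO_tail0 => m.
pose p i := if q m i == 0 then 1 else 1 - q m i.+1 / q m i.
have pE i : cond_next P A m i = (p i)%:E by rewrite cond_nextE.
have p_ge0 i : 0 <= p i by rewrite -lee_fin -pE.
pose s n := \sum_(m <= i < n) p i.
have s_ge0 n : 0 <= s n by exact: sumr_ge0.
have le_s n k : (m <= n)%N -> (n <= k)%N -> s n <= s k.
  by move=> mn nk; rewrite /s [leRHS](big_cat_nat _ (n := n))//= lerDl sumr_ge0.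
have qs n : (m <= n)%N -> q m n * (1 + s n) <= 1.
  elim: n => [|n IHn].
    by rewrite leqn0 => /eqP m0; rewrite /s big_geq ?m0// addr0 mulr1 pr_le1.
  rewrite leq_eqVlt => /predU1P[<-|].
    by rewrite /s big_geq// addr0 mulr1 pr_le1.
  rewrite ltnS => mn; apply: le_trans (IHn mn).
  have qq : q m n.+1 = q m n * (1 - p n).
    rewrite /p; have [qn0|qn0] := eqVneq (q m n) 0; last by field.
    rewrite qn0 mul0r; apply/eqP; rewrite eq_le q_ge0 andbT -qn0.
    exact: le_q.
  rewrite qq -mulrA ler_wpM2l// /s big_nat_recr//= -/(s n).
  have := p_ge0 n; have := s_ge0 n; nra.
apply/cvgrPdist_lt => e e0.
have [n mn hn] : exists2 n, (m <= n)%N & e^-1 <= s n.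
  apply: contrapT => bnd.
  have : (\sum_(m <= i <oo) cond_next P A m i <= (e^-1)%:E)%E.
    apply: lime_le; first exact: is_cvg_nneseries.
    exists m => // n /= mn.
    under eq_bigr do rewrite pE; rewrite sumEFin lee_fin leNgt; apply/negP => /ltW ?.
    by apply: bnd; exists n.
  by rewrite hB leye_eq.
exists n => // k /= nk; rewrite sub0r normrN ger0_norm//.
have sk := le_trans hn (le_s _ _ mn nk).
have h := qs k (leq_trans mn nk).
have s1 : 0 < 1 + s k by rewrite ltr_pwDl.
rewrite -(ltr_pM2r s1); apply: (le_lt_trans h).
rewrite mulrDr mulr1 ltr_pwDl// -ler_pdivrMl//.
by rewrite mulr1.
Qed.

End ConditionB.

(** * Nonpositive correlations and the law of large numbers *)

Section NonpositiveCorrelation.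
Context d (T : measurableType d) (R : realType) (P : probability T R).
Variables (A : nat -> set T) (mA : forall n, measurable (A n)).

Let mAI i j : measurable (A i `&` A j).
Proof. exact: measurableI. Qed.

Lemma cond_IND_PWI : cond_IND P A -> cond_PWI P A.
Proof.
move=> [N ind]; exists N => i j Ni Nj ij.
have := ind (i |` [fset j])%fset.
rewrite big_fsetU1 ?inE//= big_seq_fset1.
rewrite (_ : \bigcap_(k in _) _ = A i `&` A j).
  by apply=> k; rewrite !inE => /orP[] /eqP ->.
apply/seteqP; split => w.
  by move=> h; split; apply: h; rewrite /= !inE eqxx ?orbT.
by move=> [Ai Aj] k /=; rewrite !inE => /orP[] /eqP ->.
Qed.

Lemma cond_PWI_NOP : cond_PWI P A -> cond_NOP P A.
Proof.
move=> [N pwi]; exists N => i j Ni Nj ij.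
rewrite covariance_indic// lee_fin /pr pwi// fineM ?fin_num_measure//.
by rewrite subrr.
Qed.

(** Only the pairs with [i = j] or with [minn i j < N] can have a positive
    covariance.  The diagonal contributes at most [smean], and each of the
    [N] exceptional rows and columns contributes at most [smean] again. *)
Lemma NOP_smom2 : cond_NOP P A ->
  exists2 C, 0 < C & forall n, smom2 P A n <= smean P A n ^+ 2 + C * smean P A n.
Proof.
move=> [N nop]; exists (1 + N%:R *+ 2); first by rewrite ltr_pwDl.
move=> n; rewrite -lerBlDl /smom2 expr2 /smean mulr_suml -sumrB.
have pN (i : nat) : 0 <= pr P (A i) by exact: pr_ge0.
apply: (@le_trans _ _ (\sum_(i < n.+1) (pr P (A i) +
   ((i < N)%N%:R * smean P A n + pr P (A i) * N%:R)))).
  apply: ler_sum => i _; rewrite mulr_sumr -sumrB.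
  apply: (@le_trans _ _ (\sum_(j < n.+1) ((i == j)%:R * pr P (A i) +
     ((i < N)%N%:R * pr P (A j) + pr P (A i) * (j < N)%N%:R)))).
    apply: ler_sum => j _.
    have le1 : pr P (A i `&` A j) <= pr P (A i) by apply: le_pr => // w [].
    have le2 : pr P (A i `&` A j) <= pr P (A j) by apply: le_pr => // w [].
    have ge0 := mulr_ge0 (pN i) (pN j).
    have p1 := pN i; have p2 := pN j.
    have [ij|ij] := eqVneq i j.
      rewrite mul1r -[leLHS]addr0 lerD//; first by rewrite lerBlDr ler_wpDr.
      by rewrite addr_ge0 ?mulr_ge0.
    rewrite mul0r add0r.
    have [iN|Ni] := ltnP i N.
      have : 0 <= pr P (A i) * (j < N)%N%:R by rewrite mulr_ge0.
      by rewrite mul1r; lra.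
    have [jN|Nj] := ltnP j N; first by rewrite mulr1 mul0r add0r; lra.
    rewrite mul0r mulr0 addr0.
    by have := nop i j Ni Nj ij; rewrite covariance_indic// lee_fin; lra.
  rewrite !big_split/= -mulr_sumr -mulr_sumr lerD//.
    rewrite (bigD1 i)//= eqxx mul1r big1 ?addr0//.
    by move=> j ij; rewrite eq_sym (negbTE ij) mul0r.
  by rewrite lerD// ler_wpM2l ?sum_ltn_le.
rewrite !big_split/= -!mulr_suml mulrDl mul1r lerD// mulr2n mulrDl lerD//.
  by rewrite ler_wpM2r ?sum_ltn_le//; exact: smean_ge0.
by rewrite mulrC.
Qed.

End NonpositiveCorrelation.

Section LinearVariance.
Context d (T : measurableType d) (R : realType) (P : probability T R).
Variables (A : nat -> set T) (mA : forall n, measurable (A n)).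
Hypothesis sumA : (\sum_(0 <= n <oo) P (A n) = +oo)%E.
Variables (C : R) (C0 : 0 < C).
Hypothesis var_le : forall n,
  smom2 P A n <= smean P A n ^+ 2 + C * smean P A n.

Lemma linear_variance_ER : cond_ER P A.
Proof.
apply/ER_smom2 => // e e0 N.
have [N0 hN0] := smean_unbounded mA sumA (C / e).
exists (maxn N N0); first exact: leq_maxl.
apply: (le_trans (var_le _)); rewrite mulrDl mul1r lerD2l expr2 mulrA.
rewrite ler_wpM2r ?smean_ge0// -ler_pdivrMl// mulrC.
by apply: hN0; exact: leq_maxr.
Qed.

(** Here [s1 <= S <= s2] are counts at three successive times, of means [m1],
    [mu] and [m2]; replacing [m1] or [m2] by [mu] costs at most a factor
    [((k + 1) ^ 4 + 1) / k ^ 4].  The constant [33] is [5 + 10 + 10 + 6 + 2],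
    the sum of the lower coefficients of [((k + 1) ^ 4 + 1) * (k + 1)], each
    lower power of [k >= 1] being at most [k ^ 4]. *)
Lemma interpolation (k S mu s1 m1 s2 m2 : R) : 1 <= k -> s1 <= S -> S <= s2 ->
  k ^+ 4 <= m1 -> 0 < m2 -> m2 <= (k + 1) ^+ 4 + 1 ->
  k ^+ 4 <= mu -> mu <= (k + 1) ^+ 4 -> 0 <= s1 ->
  `|s1 / m1 - 1| < k^-1 -> `|s2 / m2 - 1| < k^-1 ->
  `|S / mu - 1| <= 33 / k.
Proof.
move=> k1 s1S Ss2 km1 m2_gt0 m2k kmu muk s10 h1 h2.
have k0 : 0 < k by lra.
have k4 : 0 < k ^+ 4 by exact: exprn_gt0.
have mu0 : 0 < mu by lra.
have m10 : 0 < m1 by lra.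
have k12 : k <= k ^+ 2 by rewrite expr2 ler_peMl// ltW.
have k23 : k ^+ 2 <= k ^+ 3 by rewrite [leRHS]exprS ler_peMl// exprn_ge0// ltW.
have k34 : k ^+ 3 <= k ^+ 4 by rewrite [leRHS]exprS ler_peMl// exprn_ge0// ltW.
have upper : S <= mu * (1 + 33 / k).
  have hs2 : s2 <= ((k + 1) ^+ 4 + 1) * (1 + k^-1).
    have : s2 / m2 <= 1 + k^-1 by move: h2; rewrite ltr_norml => /andP[_]; lra.
    rewrite ler_pdivrMr// mulrC => /le_trans; apply.
    by rewrite ler_wpM2r// addr_ge0// invr_ge0 ltW.
  apply: (le_trans Ss2); apply: (le_trans hs2).
  apply: (@le_trans _ _ (k ^+ 4 * (1 + 33 / k))); last first.
    by rewrite ler_wpM2r// addr_ge0// divr_ge0// ltW.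
  have -> : ((k + 1) ^+ 4 + 1) * (1 + k^-1) = ((k + 1) ^+ 4 + 1) * (k + 1) / k.
    by field; rewrite gt_eqF.
  have -> : k ^+ 4 * (1 + 33 / k) = k ^+ 4 * (k + 33) / k.
    by field; rewrite gt_eqF.
  by rewrite ler_pM2r ?invr_gt0//; lra.
have lower : mu * (1 - 33 / k) <= S.
  apply: le_trans s1S.
  have [k33|k33] := leP k 33.
    apply: le_trans s10; rewrite pmulr_rle0// subr_le0 ler_pdivlMr// mul1r//.
  have hs1 : k ^+ 4 * (1 - k^-1) <= s1.
    have : 1 - k^-1 <= s1 / m1 by move: h1; rewrite ltr_norml => /andP[]; lra.
    rewrite ler_pdivlMr// mulrC; apply: le_trans.
    by rewrite ler_wpM2r// subr_ge0 invf_le1.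
  apply: le_trans hs1.
  apply: (@le_trans _ _ ((k + 1) ^+ 4 * (1 - 33 / k))).
    by rewrite ler_wpM2r// subr_ge0 ler_pdivrMr// mul1r ltW.
  have -> : (k + 1) ^+ 4 * (1 - 33 / k) = (k + 1) ^+ 4 * (k - 33) / k.
    by field; rewrite gt_eqF.
  have -> : k ^+ 4 * (1 - k^-1) = k ^+ 4 * (k - 1) / k.
    by field; rewrite gt_eqF.
  by rewrite ler_pM2r ?invr_gt0//; lra.
rewrite ler_norml; apply/andP; split.
  by rewrite lerBrDr addrC ler_pdivlMr// mulrC.
by rewrite lerBlDl ler_pdivrMr// mulrC.
Qed.

(** Let [t k] be the first time the mean reaches [k ^+ 4]; it overshoots by at
    most [1].  By Chebyshev, [X_(t k)] deviates by [1 / k] with probability at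
    most [C / k ^+ 2], which is summable, so almost surely this happens only
    finitely often.  For arbitrary [n], choose [k] with
    [k ^+ 4 <= mu_n < (k + 1) ^+ 4]; then [t k <= n <= t k.+1]. *)
Lemma linear_variance_D : cond_D P A.
Proof.
have hit k : exists n, k%:R ^+ 4 <= smean P A n.
  by have [n hn] := smean_unbounded mA sumA (k%:R ^+ 4); exists n; exact: hn.
pose t k := ex_minn (hit k).
have t_ge k : k%:R ^+ 4 <= smean P A (t k) by rewrite /t; case: ex_minnP.
have t_min k n : k%:R ^+ 4 <= smean P A n -> (t k <= n)%N.
  by rewrite /t; case: ex_minnP => m _; exact.
have t_le k : smean P A (t k) <= k%:R ^+ 4 + 1.
  case tk : (t k) => [|n].
    rewrite /smean big_ord1 (le_trans (pr_le1 P (mA _)))//.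
    by rewrite lerDr exprn_ge0.
  apply: (le_trans (smeanS_le P mA n)); rewrite lerD2r leNgt; apply/negP => /ltW.
  by move=> /t_min; rewrite tk ltnn.
pose F k := [set w | k.+1%:R^-1 <= `|Xratio P A (t k.+1) w - 1|].
have mF k : measurable (F k) by exact: measurable_dev.
have PF k : pr P (F k) <= C / k.+1%:R ^+ 2.
  have k0 : 0 < k.+1%:R :> R by rewrite ltr0n.
  have mu0 : 0 < smean P A (t k.+1).
    by apply: lt_le_trans (t_ge _); exact: exprn_gt0.
  apply: (le_trans (chebyshev_Xratio mA _ mu0)); first by rewrite invr_gt0.
  rewrite ler_pdivrMr; last by rewrite exprn_gt0// mulr_gt0// invr_gt0.
  apply: (@le_trans _ _ (C * smean P A (t k.+1))).
    by rewrite lerBlDl; exact: var_le.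
  have := t_ge k.+1; set K := k.+1%:R in k0 *; set mu := smean P A _ in mu0 * => Kmu.
  have -> : C / K ^+ 2 * (K^-1 * mu) ^+ 2 = C * mu * (mu / K ^+ 4).
    by field; rewrite gt_eqF.
  rewrite ler_peMr ?mulr_ge0 ?(ltW C0) ?(ltW mu0)//.
  by rewrite ler_pdivlMr ?mul1r// exprn_gt0.
have sumF : (\sum_(0 <= k <oo) P (F k) <= (C * 2)%:E)%E.
  apply: lime_le; first by apply: is_cvg_nneseries => *; exact: measure_ge0.
  apply: nearW => n; rewrite big_mkord; under eq_bigr do rewrite prE//.
  rewrite sumEFin lee_fin; apply: (@le_trans _ _ (\sum_(k < n) C / k.+1%:R ^+ 2)).
    by apply: ler_sum => k _; exact: PF.
  rewrite -mulr_sumr ler_wpM2l ?(ltW C0)//.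
  (* telescoping bound for the sum of the inverse squares *)
  suff : \sum_(k < n.+1) (k.+1%:R ^+ 2)^-1 <= 2 - n.+1%:R^-1 :> R.
    rewrite big_ord_recr/=; set x := (_ ^+ 2)^-1; set y := n.+1%:R^-1.
    have : 0 <= x by rewrite invr_ge0 exprn_ge0.
    have : 0 <= y by rewrite invr_ge0.
    lra.
  elim: n => [|n IHn]; first by rewrite big_ord1 expr1n invr1; lra.
  rewrite big_ord_recr/=.
  have n0 : 0 < n.+1%:R :> R by rewrite ltr0n.
  have -> : n.+2%:R = n.+1%:R + 1 :> R by rewrite -natr1.
  set x := n.+1%:R in IHn n0 *.
  apply: (@le_trans _ _ (2 - x^-1 + ((x + 1) ^+ 2)^-1)); first by rewrite lerD2r.
  have : x^-1 - (x + 1)^-1 - ((x + 1) ^+ 2)^-1 = (x * (x + 1) ^+ 2)^-1.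
    by field; rewrite !gt_eqF// ltr_pwDr.
  have : 0 <= (x * (x + 1) ^+ 2)^-1.
    by rewrite invr_ge0 mulr_ge0 ?ltW// exprn_gt0// ltr_pwDr.
  move: (_^-1) (x^-1) ((x + 1)^-1) (_^-1) => y a b c; lra.
have limF0 : P (lim_sup_set F) = 0%E.
  by apply: lim_sup_set_cvg0 => //; apply: (le_lt_trans sumF); exact: ltry.
have mlim : measurable (lim_sup_set F).
  by apply: bigcapT_measurable => k; exact: bigcup_measurable.
exists (lim_sup_set F); split=> // w /= ncvg; apply: contrapT => Fw; apply: ncvg.
have [K0 hK0] : exists K0, forall k, (K0 <= k)%N -> ~ F k w.
  apply: contrapT => h; apply: Fw => n _ /=; apply: contrapT => h'; apply: h.
  by exists n => k nk Fk; apply: h'; exists k.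
apply/cvgrPdist_lt => e e0.
pose K := (maxn K0.+1 (Num.bound (33 / e)).+1).
have eK : 33 / e < K%:R.
  apply: (@lt_le_trans _ _ (Num.bound (33 / e))%:R).
    by rewrite archi_boundP// divr_ge0// ltW.
  by rewrite ler_nat /K; lia.
have [N hN] := smean_unbounded mA sumA (K%:R ^+ 4).
exists N => // n /= Nn; have mun := hN _ Nn.
have bnd k : k%:R ^+ 4 <= smean P A n -> (k <= Num.bound (smean P A n))%N.
  move=> kmu; rewrite -(ler_nat R).
  apply: le_trans (ltW (archi_boundP (smean_ge0 P A n))).
  apply: le_trans kmu; rewrite -natrX ler_nat.
  by case: k => // k; rewrite -[leqLHS]expn1 leq_pexp2l.
have [k kmu kmax] :=
  ex_maxnP (ex_intro (fun k => k%:R ^+ 4 <= smean P A n) K mun) bnd.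
have Kk : (K <= k)%N by exact: kmax.
have k1 : (0 < k)%N by apply: leq_trans Kk; rewrite /K; lia.
have tkn : (t k <= n)%N by exact: t_min.
have muk : smean P A n < k.+1%:R ^+ 4.
  by rewrite ltNge; apply/negP => /kmax; rewrite ltnn.
have ntk : (n <= t k.+1)%N.
  rewrite leqNgt; apply/negP => /ltnW /(le_smean P A) h.
  by have := lt_le_trans (le_lt_trans h muk) (t_ge k.+1); rewrite ltxx.
have mu0 : 0 < smean P A n.
  by apply: lt_le_trans kmu; rewrite exprn_gt0// ltr0n.
have tk0 j : (0 < j)%N -> 0 < smean P A (t j).
  by move=> j0; apply: lt_le_trans (t_ge j); rewrite exprn_gt0// ltr0n.
have dev j : (k <= j)%N -> `|Ssum R A (t j) w / smean P A (t j) - 1| < k%:R^-1.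
  case: j => [|j kj]; first by rewrite leqn0 => /eqP k0; rewrite k0 in k1.
  have jK : (K0 <= j)%N by move: (leq_trans Kk kj); rewrite /K; lia.
  have := hK0 _ jK; rewrite /F/= Xratio_neq0 ?gt_eqF ?tk0// => /negP.
  rewrite -ltNge => /lt_le_trans; apply.
  by rewrite lef_pV2 ?posrE ?ltr0n// ler_nat.
rewrite distrC Xratio_neq0 ?gt_eqF//.
apply: (@le_lt_trans _ _ (33 / k%:R)).
  apply: (@interpolation _ _ _ (Ssum R A (t k) w) (smean P A (t k))
    (Ssum R A (t k.+1) w) (smean P A (t k.+1))) => //.
  - by rewrite ler1n.
  - exact: le_Ssum.
  - exact: le_Ssum.
  - exact: tk0.
  - by rewrite natr1.
  - by rewrite natr1 ltW.
  - exact: Ssum_ge0.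
  - exact: dev.
  - by apply: dev.
rewrite ltr_pdivrMr ?ltr0n// -ltr_pdivrMl// mulrC.
by apply: (lt_le_trans eK); rewrite ler_nat.
Qed.

End LinearVariance.

(** * Counterexamples on the geometric law *)

Section GeometricLaw.
Context (R : realType).

Definition geometric_mass (k : nat) : {nonneg R} :=
  NngNum (divr_ge0 (@ler01 R) (ler0n R (2 ^ (k + 1)))).

Definition geometric_law : set nat -> \bar R :=
  mseries (fun k => mscale (geometric_mass k) (\d_k)) 0.

HB.instance Definition _ := Measure.on geometric_law.

Let geometric_law_setT : geometric_law setT = 1%E.
Proof.
rewrite /geometric_law /mseries/= /mscale/=.
under eq_eseriesr do rewrite diracT mule1.
by have := @cvg_geometric_eseries_half R 1 0; rewrite expr0 divr1 => /cvg_lim <-.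
Qed.

HB.instance Definition _ :=
  @Measure_isProbability.Build _ _ R geometric_law geometric_law_setT.

Lemma pr_geometric k : pr geometric_law [set k] = 2^-1 ^+ k.+1.
Proof.
rewrite /pr /= /geometric_law /mseries /= /mscale /=.
rewrite (@nneseriesD1 _ _ k)//=; last by move=> i _; rewrite mule_ge0.
rewrite eseries0 ?adde0; last first.
  by move=> i _ ik; rewrite diracE memNset ?mule0// => /= ik'; rewrite ik' eqxx in ik.
by rewrite diracE mem_set// mule1/= addn1 div1r natrX exprVn.
Qed.

End GeometricLaw.

Section Divergence.
Context d (T : measurableType d) (R : realType) (P : probability T R).
Variables (A : nat -> set T) (mA : forall n, measurable (A n)).

Lemma sum_pr_infty : (forall M : nat, exists n, M%:R <= smean P A n) ->
  (\sum_(0 <= n <oo) P (A n) = +oo)%E.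
Proof.
move=> unb; apply: eq_infty => r.
have [n hn] := unb (Num.bound `|r|).
apply: (@le_trans _ _ (smean P A n)%:E).
  rewrite lee_fin (le_trans _ hn)// (le_trans (ler_norm _))// ltW//.
  by rewrite archi_boundP.
have -> : (smean P A n)%:E = (\sum_(0 <= i < n.+1) P (A i))%E.
  by rewrite big_mkord /smean -sumEFin; apply: eq_bigr => i _; rewrite prE.
by apply: nneseries_lim_ge.
Qed.

Lemma sum_pr_infty_half : (forall n, 2^-1 <= pr P (A n)) ->
  (\sum_(0 <= n <oo) P (A n) = +oo)%E.
Proof.
move=> half; apply: sum_pr_infty => M; exists (2 * M)%N.
apply: (@le_trans _ _ (\sum_(i < (2 * M).+1) 2^-1)); last first.
  by apply: ler_sum => i _; exact: half.
rewrite sumr_const card_ord mulrS.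
have : 2^-1 *+ (2 * M) = M%:R :> R.
  by rewrite mulrnA -(mulr_natr 2^-1 2) mulVf ?pnatr_eq0.
lra.
Qed.

End Divergence.

(** Complements of disjoint events are negatively correlated. *)
Lemma NOP_not_PWI (R : realType) : ~ cond_implies R NOP PWI.
Proof.
move=> /(_ _ nat (geometric_law R) (fun n => ~` [set n])).
have mA (F : set nat) : measurable F by [].
have prA n : pr (geometric_law R) (~` [set n]) = 1 - 2^-1 ^+ n.+1.
  by rewrite pr_setC// pr_geometric.
have prAI i j : i != j ->
    pr (geometric_law R) (~` [set i] `&` ~` [set j])
    = 1 - 2^-1 ^+ i.+1 - 2^-1 ^+ j.+1.
  move=> ij; rewrite -setCU pr_setC// pr_setU//.
    by rewrite !pr_geometric opprD addrA.
  by apply/seteqP; split => // x [/= -> /eqP]; rewrite (negbTE ij).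
have half_pos n : 0 < 2^-1 ^+ n :> R by rewrite exprn_gt0.
move=> /(_ (fun _ => mA _)) []//.
- apply: sum_pr_infty_half => // n; rewrite prA.
  by have : 2^-1 ^+ n <= 1 :> R; [rewrite exprn_ile1//; lra|rewrite exprS; lra].
- exists 0%N => i j _ _ ij; rewrite covariance_indic// lee_fin prAI// !prA.
  have := mulr_gt0 (half_pos i.+1) (half_pos j.+1); lra.
- move=> N /(_ N N.+1 (leqnn _) (leqnSn _) _)/=.
  rewrite neq_ltn ltnSn => /(_ isT); rewrite !prE// => -[].
  rewrite prAI ?neq_ltn ?ltnSn// !prA.
  have := mulr_gt0 (half_pos N.+1) (half_pos N.+2); lra.
Qed.

(** Infinitely many sure events give IO.  At the point [0], of probability
    [1/2], all events occur, so [S_n = n.+1], whereas [mu_n] is about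
    [3/4 * n.+1]: the ratio is at least [6/5] for every [n >= 1]. *)
Section IO_not_SUB.
Context (R : realType).
Let G : probability nat R := geometric_law R.
Let A (n : nat) : set nat := if odd n then [set 0%N] else setT.
Let mA n : measurable (A n). Proof. by []. Qed.

Let prA n : pr G (A n) = 1 - (odd n)%:R / 2.
Proof.
rewrite /A; case: ifP => _; last by rewrite pr_setT mul0r subr0.
by rewrite pr_geometric expr1 mul1r; lra.
Qed.

Lemma IO_not_SUB : ~ cond_implies R IO SUB.
Proof.
move=> /(_ _ nat G A mA) [].
- apply: sum_pr_infty_half => // n; rewrite prA.
  by case: (odd n); rewrite ?mul1r ?mul0r; lra.
- rewrite /satisfies /cond_IO (_ : \bigcap_m _ = setT) ?probability_setT//.
  apply/seteqP; split => // w _ m _; exists m.*2; first by rewrite /= -addnn leq_addr.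
  by rewrite /A odd_double.
move=> phi [phiS /(_ (1 / 5))]; rewrite divr_gt0// => /(_ isT) cvg0.
have phi_ge k : (k <= phi k)%N.
  by elim: k => // k IHk; exact: leq_ltn_trans (phiS k).
have smeanA n : smean G A n = n.+1%:R - (n.+1)./2%:R / 2.
  rewrite /smean; elim: n.+1 => [|m IHm]; first by rewrite big_ord0 mul0r subr0.
  rewrite big_ord_recr/= IHm prA -!natr1 uphalf_half natrD mulrDl.
  by rewrite opprD !addrA; lra.
have S0 n : Ssum R A n 0%N = n.+1%:R.
  rewrite /Ssum (eq_bigr (fun=> 1)) ?sumr_const ?card_ord// => i _.
  by rewrite indicE mem_set// /A; case: ifP.
have dev n : (0 < n)%N -> [set 0%N] `<=` [set w | 1 / 5 <= `|Xratio G A n w - 1|].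
  move=> n0 w /= ->.
  have h : 3%:R * (n.+1)./2%:R >= n.+1%:R :> R by rewrite -natrM ler_nat; lia.
  have h' : (n.+1)./2%:R <= n.+1%:R :> R by rewrite ler_nat; lia.
  have n1 : 0 < n.+1%:R :> R by rewrite ltr0n.
  have mu0 : 0 < smean G A n by rewrite smeanA; lra.
  rewrite Xratio_neq0 ?gt_eqF// S0 (le_trans _ (ler_norm _))// lerBrDr.
  by rewrite ler_pdivlMr// smeanA; lra.
have : (2^-1%:E <= (0 : \bar R))%E.
  rewrite -(cvg_lim (@ereal_hausdorff _) cvg0); apply: lime_ge.
    exact: cvgP cvg0.
  near=> k; apply: (@le_trans _ _ (G [set 0%N])).
    by rewrite prE// pr_geometric expr1.
  apply: le_measure; rewrite ?inE//; apply: dev; apply: leq_trans (phi_ge k).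
  by near: k; exists 1%N.
by rewrite lee_fin; lra.
Unshelve. all: by end_near. Qed.

End IO_not_SUB.

(** For [n.+2] running from [2 ^ K.+1] to [2 ^ K.+2 - 1], the event [A n] is {0}
    in the first half of the range and its complement in the second half.  At
    the end of each range both have occurred equally often, so [S_n] is
    constant and [E X_n ^+ 2 = 1].  In the middle of a range, [X_n] is at
    least [4/3] at the point [0]. *)
Section ER_not_D.
Context (R : realType).
Let G : probability nat R := geometric_law R.

Lemma ae_geometric (Q : nat -> Prop) : {ae G, forall w, Q w} -> forall w, Q w.
Proof.
move=> [N [mN N0 QN]] w; apply: contrapT => Qw.
have : pr G [set w] <= pr G N by apply: le_pr => // _ /= ->; exact: QN.
by rewrite pr_geometric /pr N0 leNgt exprn_gt0.
Qed.

Let b n := (2 * n.+2 < 3 * 2 ^ trunc_log 2 n.+2)%N.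
Let A n : set nat := if b n then [set 0%N] else ~` [set 0%N].
Let mA n : measurable (A n). Proof. by []. Qed.

Let prA n : pr G (A n) = 2^-1.
Proof.
by rewrite /A; case: ifP => _; rewrite ?pr_setC// pr_geometric expr1//; lra.
Qed.

Let smeanA n : smean G A n = n.+1%:R / 2.
Proof.
rewrite /smean (eq_bigr (fun=> 2^-1)) => [|i _]; last exact: prA.
by rewrite sumr_const card_ord mulr_natl.
Qed.

Let cnt m : nat := (\sum_(0 <= i < m) b i)%N.

Let cnt_up K : cnt (3 * 2 ^ K - 2) = (cnt (2 ^ K.+1 - 2) + 2 ^ K)%N.
Proof.
have K0 : (0 < 2 ^ K)%N by rewrite expn_gt0.
rewrite /cnt (big_cat_nat _ (n := (2 ^ K.+1 - 2)%N))//=; last by rewrite expnS; lia.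
congr addn; rewrite (@eq_big_nat _ _ _ _ _ _ (fun=> 1%N)).
  by rewrite sum_nat_const_nat expnS; lia.
move=> i ib; have kE : trunc_log 2 i.+2 = K.+1.
  by apply: trunc_log_eq => //; move: ib; rewrite !expnS; lia.
by rewrite /b kE (_ : (_ < _)%N)//; move: ib; rewrite !expnS; lia.
Qed.

Let cnt_down K : cnt (2 ^ K.+2 - 2) = cnt (3 * 2 ^ K - 2).
Proof.
have K0 : (0 < 2 ^ K)%N by rewrite expn_gt0.
rewrite /cnt (big_cat_nat _ (n := (3 * 2 ^ K - 2)%N))//=; last by rewrite !expnS; lia.
rewrite -[RHS]addn0; congr addn; rewrite big_nat big1// => i ib.
have kE : trunc_log 2 i.+2 = K.+1.
  by apply: trunc_log_eq => //; move: ib; rewrite !expnS; lia.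
by rewrite /b kE (_ : (_ < _)%N = false)//; move: ib; rewrite !expnS; lia.
Qed.

Let cnt_balanced K : cnt (2 ^ K.+1 - 2) = (2 ^ K - 1)%N.
Proof.
elim: K => [|K IHK]; first by rewrite /cnt big_geq.
by rewrite cnt_down cnt_up IHK expnS; lia.
Qed.

Let SsumE n w : Ssum R A n w =
  if w == 0%N then (cnt n.+1)%:R else (n.+1 - cnt n.+1)%N%:R.
Proof.
have cntS m : cnt m.+1 = (cnt m + b m)%N by rewrite /cnt big_nat_recr.
have cnt_le m : (cnt m <= m)%N.
  by elim: m => [|m IHm]; [rewrite /cnt big_geq|rewrite cntS; case: (b m); lia].
rewrite /Ssum; elim: n.+1 => [|m IHm].
  by rewrite big_ord0 /cnt big_geq//; case: ifP.
rewrite big_ord_recr/= IHm cntS indicE /A.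
have [w0|w0] := eqVneq w 0%N; case: (b m).
- by rewrite mem_set// natrD.
- by rewrite memNset ?addr0 ?addn0//= => /(_ w0).
- rewrite memNset; last by move=> /eqP; rewrite (negbTE w0).
  by rewrite addr0 addn1 subSS.
- rewrite mem_set; last exact/eqP.
  by rewrite addn0 -natrD; congr _%:R; have := cnt_le m; lia.
Qed.

Lemma ER_not_D : ~ cond_implies R ER D.
Proof.
have sumA : (\sum_(0 <= n <oo) G (A n) = +oo)%E.
  by apply: sum_pr_infty_half => // n; rewrite prA.
move=> /(_ _ nat G A mA sumA) ER_D.
have {}/ER_D cvgX : cond_ER G A.
  apply/ER_smom2 => // e e0 N.
  have NK : (N < 2 ^ N)%N by exact: ltn_expl.
  exists (2 ^ N.+2 - 3)%N; first by rewrite !expnS; lia.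
  have nE : (2 ^ N.+2 - 3).+1 = (2 ^ N.+2 - 2)%N by rewrite !expnS; lia.
  have SE w : Ssum R A (2 ^ N.+2 - 3) w = smean G A (2 ^ N.+2 - 3).
    rewrite SsumE smeanA nE cnt_balanced.
    have -> : (2 ^ N.+2 - 2 = (2 ^ N.+1 - 1) * 2)%N by rewrite !expnS; lia.
    rewrite natrM mulfK// (_ : (_ * 2 - _)%N = (2 ^ N.+1 - 1)%N); last by lia.
    by case: ifP.
  have : smom2 G A (2 ^ N.+2 - 3) = smean G A (2 ^ N.+2 - 3) ^+ 2.
    apply: EFin_inj; rewrite -expectation_sqr_Ssum// -(expectation_cst G).
    by congr expectation; apply/funext => w; rewrite SE.
  by move=> ->; rewrite mulrDl mul1r lerDl mulr_ge0 ?sqr_ge0 ?ltW.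
have /cvgrPdist_lt := ae_geometric cvgX 0%N.
have third0 : 0 < 1 / 3 :> R by lra.
move=> /(_ _ third0)[N _ hN].
have NK : (N < 2 ^ N)%N by exact: ltn_expl.
have := hN (3 * 2 ^ N.+1 - 3)%N.
have nE : (3 * 2 ^ N.+1 - 3).+1 = (3 * 2 ^ N.+1 - 2)%N by rewrite !expnS; lia.
have cE : cnt (3 * 2 ^ N.+1 - 2) = (2 ^ N.+2 - 1)%N.
  by rewrite cnt_up cnt_balanced !expnS; lia.
have mu0 : 0 < smean G A (3 * 2 ^ N.+1 - 3) by rewrite smeanA divr_gt0// ltr0n.
rewrite /= Xratio_neq0 ?gt_eqF// SsumE/= smeanA nE cE distrC.
have -> : (N <= 3 * 2 ^ N.+1 - 3)%N by rewrite !expnS; lia.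
move=> /(_ isT); rewrite ltr_norml => /andP[_].
rewrite ltrBlDr ltr_pdivrMr; last by rewrite divr_gt0// ltr0n; lia.
have : (2 * (3 * 2 ^ N.+1 - 2))%:R <= (3 * (2 ^ N.+2 - 1))%:R :> R.
  by rewrite ler_nat !expnS; lia.
rewrite !natrM; lra.
Qed.

End ER_not_D.

Lemma sqr_le_exp2 m : (6 <= m)%N -> (4 * (m + 5) ^ 2 <= 9 * 2 ^ m)%N.
Proof.
move=> m6; rewrite -(subnK m6); elim: (m - 6)%N => // j IHj.
set x := (j + 6)%N in IHj *; rewrite (_ : (j.+1 + 6)%N = x.+1)// (expnS 2 x).
have : ((x.+1 + 5) ^ 2 <= 2 * (x + 5) ^ 2)%N by rewrite -!mulnn; nia.
lia.
Qed.

(** For [n.+1] running from [4 ^ j] to [4 ^ j.+1 - 1], the first event is sure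
    and the others are the singleton of [3 * j], of probability of order
    [8 ^- j].  Each point belongs to finitely many singletons, and their
    probabilities sum to at most [3].  Hence [S_n] and [mu_n] both stay within
    a bounded distance of the number [t n] of sure events, which tends to
    infinity, and D holds.  But for [n] in the next range, the point [3 * j]
    alone contributes about [(3 * 4 ^ j) ^+ 2 * 8 ^- j], of order [2 ^ j], to
    the second moment, while [mu_n ^+ 2] is only of order [j ^+ 2]. *)
Section D_not_ER.
Context (R : realType).
Let G : probability nat R := geometric_law R.

Let k i := trunc_log 4 i.+1.
Let first i := i.+1 == (4 ^ k i)%N.
Let A i : set nat := if first i then setT else [set (3 * k i)%N].
Let mA n : measurable (A n). Proof. by []. Qed.

Let prA i : pr G (A i) = if first i then 1 else 2^-1 ^+ (3 * k i).+1.
Proof. by rewrite /A; case: ifP => _; rewrite ?pr_setT// pr_geometric. Qed.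

(* the sum over the first [K] blocks: one sure event and [3 * 4 ^ j - 1]
   singletons in block [j] *)
Let block_sum (F : bool -> nat -> R) K :
  \sum_(0 <= i < 4 ^ K - 1) F (first i) (k i) =
  \sum_(j < K) (F true j + F false j *+ (3 * 4 ^ j - 1)).
Proof.
elim: K => [|K IHK]; first by rewrite big_ord0 big_geq.
have K0 : (0 < 4 ^ K)%N by rewrite expn_gt0.
rewrite (big_cat_nat _ (n := (4 ^ K - 1)%N))//=; last by rewrite expnS; lia.
rewrite IHK big_ord_recr/=; congr (_ + _).
have kE i : (4 ^ K - 1 <= i < 4 ^ K.+1 - 1)%N -> k i = K.
  by move=> iK; apply: trunc_log_eq => //; lia.
rewrite big_ltn; last by rewrite expnS; lia.
congr (_ + _).
  by rewrite /first kE; [congr F; apply/eqP; lia|rewrite expnS; lia].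
rewrite (@eq_big_nat _ _ _ _ _ _ (fun=> F false K)).
  by rewrite sumr_const_nat; congr (_ *+ _); rewrite expnS; lia.
move=> i iK; rewrite /first kE; last by lia.
by congr F; apply/eqP; lia.
Qed.

Let block_lt n : (n < 4 ^ (k n).+1 - 1)%N.
Proof. by have := @trunc_log_ltn 4 n.+1 isT; rewrite -/(k n); lia. Qed.

Let block_ge n : (4 ^ k n - 1 <= n)%N.
Proof. by have := @trunc_logP 4 n.+1 isT isT; rewrite -/(k n); lia. Qed.

Let sum_le (F : bool -> nat -> R) n : (forall x j, 0 <= F x j) ->
  \sum_(i < n.+1) F (first i) (k i) <=
  \sum_(j < (k n).+1) (F true j + F false j *+ (3 * 4 ^ j - 1)).
Proof.
move=> F0; rewrite -block_sum -(big_mkord xpredT (fun i => F (first i) (k i))).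
rewrite [leRHS](big_cat_nat _ (n := n.+1))//= lerDl.
by apply: sumr_ge0 => i _; exact: F0.
Qed.

Let sum_ge (F : bool -> nat -> R) n : (forall x j, 0 <= F x j) ->
  \sum_(j < k n) (F true j + F false j *+ (3 * 4 ^ j - 1)) <=
  \sum_(i < n.+1) F (first i) (k i).
Proof.
move=> F0; rewrite -block_sum -(big_mkord xpredT (fun i => F (first i) (k i))).
rewrite [leRHS](big_cat_nat _ (n := (4 ^ k n - 1)%N))//= ?lerDl.
  by apply: sumr_ge0 => i _; exact: F0.
exact: leq_trans (block_ge n) (leqnSn n).
Qed.

Let t n : R := \sum_(i < n.+1) (first i)%:R.

Let smeanE n : smean G A n = t n + \sum_(i < n.+1)
   (if first i then 0 else 2^-1 ^+ (3 * k i).+1).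
Proof.
rewrite /t -big_split/=; apply: eq_bigr => i _.
by rewrite prA; case: ifP => _; rewrite ?addr0 ?add0r.
Qed.

Let t_le n : t n <= (k n).+1%:R.
Proof.
apply: (le_trans (@sum_le (fun x _ => x%:R) n _)) => //.
by under eq_bigr do rewrite mul0rn addr0; rewrite sumr_const card_ord.
Qed.

Let t_ge n : (k n)%:R <= t n.
Proof.
apply: le_trans (@sum_ge (fun x _ => x%:R) n _) => //.
by under eq_bigr do rewrite mul0rn addr0; rewrite sumr_const card_ord.
Qed.

Let half_cube j : 2^-1 ^+ (3 * j).+1 = (2 * (2 ^+ j) ^+ 3)^-1 :> R.
Proof. by rewrite exprS mulnC exprM !exprVn -invfM. Qed.

Let pow4 j : 4 ^+ j = (2 ^+ j) ^+ 2 :> R.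
Proof. by rewrite -exprM mulnC exprM; congr (_ ^+ _); lra. Qed.

Let rest_le n : \sum_(i < n.+1)
  (if first i then 0 else 2^-1 ^+ (3 * k i).+1) <= 3 :> R.
Proof.
apply: (le_trans (@sum_le (fun x j => if x then 0 else 2^-1 ^+ (3 * j).+1) n _)).
  by move=> [] j //; rewrite exprn_ge0.
apply: (@le_trans _ _ (\sum_(j < (k n).+1) (3 / 2) * 2^-1 ^+ j)).
  apply: ler_sum => j _; rewrite add0r.
  apply: (@le_trans _ _ (2^-1 ^+ (3 * j).+1 *+ (3 * 4 ^ j))).
    by rewrite ler_wpMn2l ?exprn_ge0// leq_subr.
  rewrite -mulr_natr natrM natrX half_cube pow4 exprVn.
  have : 2 ^+ j != 0 :> R by rewrite expf_neq0.
  by move: (2 ^+ j) => x x0; rewrite le_eqVlt; apply/orP; left; apply/eqP; field.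
rewrite -mulr_sumr.
have -> m : \sum_(j < m) 2^-1 ^+ j = 2 - 2 * 2^-1 ^+ m :> R.
  elim: m => [|m IHm]; first by rewrite big_ord0; lra.
  by rewrite big_ord_recr/= IHm exprS; lra.
have : 0 <= 2^-1 ^+ (k n).+1 :> R by rewrite exprn_ge0.
lra.
Qed.

Let rest_ge0 n : 0 <= \sum_(i < n.+1)
  (if first i then 0 else 2^-1 ^+ (3 * k i).+1) :> R.
Proof. by apply: sumr_ge0 => i _; case: ifP => // _; rewrite exprn_ge0. Qed.

Let sumA : (\sum_(0 <= n <oo) G (A n) = +oo)%E.
Proof.
apply: sum_pr_infty => // M; exists (4 ^ M)%N; rewrite smeanE.
rewrite -[leLHS]addr0 lerD// (le_trans _ (t_ge _))// ler_nat.
by apply: trunc_log_max => //; exact: leqnSn.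
Qed.

Let D_A : cond_D G A.
Proof.
apply: aeW => w; apply/cvgrPdist_lt => e e0.
have Ct : (0 : R) <= (4 ^ w.+1)%:R + 3 by rewrite addr_ge0.
have [N hN] := smean_unbounded mA sumA (((4 ^ w.+1)%:R + 3) / e + 1).
exists N => // n /= Nn; have {hN Nn} mun := hN _ Nn.
have mu0 : 0 < smean G A n.
  by apply: lt_le_trans mun; rewrite ltr_wpDl// divr_ge0// ltW.
have Sn : t n <= Ssum R A n w <= t n + (4 ^ w.+1)%:R.
  apply/andP; split.
    apply: ler_sum => i _; rewrite /A indicE.
    by case: ifP => [_|_]; [rewrite mem_set|case: (_ \in _)].
  rewrite -lerBlDl -sumrB; apply: le_trans (sum_ltn_le R _ n.+1).
  apply: ler_sum => i _; rewrite /A indicE; case: ifP => [_|_].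
    by rewrite mem_set// subrr.
  have [iw|wi] := ltnP i (4 ^ w.+1); first by rewrite subr0; case: (_ \in _).
  rewrite memNset ?subrr//= => wE.
  have : (w.+1 <= k i)%N by apply: trunc_log_max => //; exact: leqW.
  by rewrite wE; lia.
rewrite distrC Xratio_neq0 ?gt_eqF//.
have -> : Ssum R A n w / smean G A n - 1
    = (Ssum R A n w - smean G A n) / smean G A n by rewrite mulrBl divff ?gt_eqF.
rewrite normrM normfV (gtr0_norm mu0) ltr_pdivrMr//.
apply: (@le_lt_trans _ _ ((4 ^ w.+1)%:R + 3)).
  move: Sn => /andP[S1 S2]; rewrite ler_norml smeanE.
  have := rest_le n; have := rest_ge0 n.
  set r := \sum_(i < n.+1) _ => r0 r3.
  have : 0 <= (4 ^ w.+1)%:R :> R by [].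
  by move=> ?; apply/andP; split; lra.
rewrite -ltr_pdivrMl// mulrC; apply: lt_le_trans mun.
by rewrite ltrDl.
Qed.

Let smom2_ge n w : Ssum R A n w ^+ 2 * pr G [set w] <= smom2 G A n.
Proof.
rewrite expr2 /Ssum !mulr_suml; apply: ler_sum => i _.
rewrite mulr_sumr mulr_suml; apply: ler_sum => j _.
rewrite -[X in X * _](_ : \1_(A i `&` A j) w = _); last by rewrite indicI.
rewrite indicE; have [|_] := boolP (w \in _); last by rewrite mul0r pr_ge0.
by rewrite inE mul1r => wij; apply: le_pr => // _ /= ->.
Qed.

Lemma D_not_ER : ~ cond_implies R D ER.
Proof.
move=> /(_ _ nat G A mA sumA D_A)/ER_smom2-/(_ mA sumA).
have half0 : 0 < 1 / 2 :> R by lra.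
move=> /(_ _ half0) fsv.
have [n k7 h] : exists2 n, (7 <= k n)%N &
    smom2 G A n <= (1 + 1 / 2) * smean G A n ^+ 2.
  (* [7] is abstracted so that [4 ^ 7] is never computed *)
  move: 7%N => K; have [n Kn hn] := fsv (4 ^ K)%N; exists n => //.
  by apply: trunc_log_max => //; exact: leq_trans Kn (leqnSn n).
have mu0 : 0 < smean G A n.
  rewrite smeanE ltr_wpDr// (lt_le_trans _ (t_ge n))// ltr0n.
  exact: leq_trans k7.
have mu_le : smean G A n <= (k n)%:R + 4.
  rewrite smeanE; have := t_le n; have := rest_le n; rewrite -natr1; lra.
have [m kE] : exists m, k n = m.+1.
  by exists (k n).-1; rewrite prednK// (leq_trans _ k7).
have S_ge : 3 * 4 ^+ m <= Ssum R A n (3 * m)%N.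
  pose F x j : R := if x then 1 else (j == m)%:R.
  rewrite (_ : Ssum R A n _ = \sum_(i < n.+1) F (first i) (k i)); last first.
    apply: eq_bigr => i _; rewrite /A /F indicE; case: ifP => _.
      by rewrite mem_set.
    have [->|km] := eqVneq (k i) m; first by rewrite mem_set.
    rewrite memNset//= => /eqP; rewrite eqn_mul2l/= => /eqP mk.
    by rewrite mk eqxx in km.
  apply: le_trans (@sum_ge F n _); last by move=> [] j; rewrite /F.
  rewrite kE big_ord_recr/= /F eqxx.
  apply: (@le_trans _ _ (1 + 1 *+ (3 * 4 ^ m - 1))).
    by rewrite -natrX -natrM -[X in X + _]/(1%:R) -natrD ler_nat; lia.
  rewrite lerDr; apply: sumr_ge0 => j _.
  by rewrite addr_ge0// mulrn_wge0.
have m2_ge : 2 * ((k n)%:R + 4) ^+ 2 <= smom2 G A n.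
  apply: le_trans (smom2_ge n (3 * m)%N).
  have m6 : (6 <= m)%N by rewrite -ltnS -kE.
  have hm : (4 * (m + 5) ^ 2 <= 9 * 2 ^ m)%N by exact: sqr_le_exp2.
  apply: (@le_trans _ _ ((3 * 4 ^+ m) ^+ 2 * 2^-1 ^+ (3 * m).+1)); last first.
    rewrite pr_geometric ler_wpM2r ?exprn_ge0//.
    by rewrite ler_pXn2r ?nnegrE ?mulr_ge0 ?exprn_ge0 ?Ssum_ge0.
  have -> : (3 * 4 ^+ m) ^+ 2 * 2^-1 ^+ (3 * m).+1 = 9 / 2 * 2 ^+ m :> R.
    rewrite half_cube pow4.
    have : 2 ^+ m != 0 :> R by rewrite expf_neq0.
    by move: (2 ^+ m) => x x0; field.
  have : (4 * (m + 5) ^ 2)%:R <= (9 * 2 ^ m)%:R :> R by rewrite ler_nat.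
  have mS : m.+1%:R = m%:R + 1 :> R by rewrite natr1.
  rewrite kE mS !natrM !natrX natrD; move: (2 ^+ m) => x; lra.
have mu2 : smean G A n ^+ 2 <= ((k n)%:R + 4) ^+ 2.
  by rewrite ler_pXn2r ?nnegrE ?addr_ge0// ltW.
have : 0 < smean G A n ^+ 2 by exact: exprn_gt0.
lra.
Qed.

End D_not_ER.

(** * A counterexample on a product space *)

(** Under the product law, [B n] is the event that the first coordinate [x] is
    at most the second coordinate [y] and that [n] is one of the two.
    Splitting according to whether [x = n <= y] or [x < n = y] gives
    [P (B n) = g n * P (y >= n) + P (x < n) * g n = g n], and for [i < j] the
    events [B i] and [B j] occur together exactly at [(i, j)], which has
    probability [g i * g j].  Thus they are pairwise independent, but three of
    them never occur together.  The complements of the [B n] inherit both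
    properties and have probability at least [1/2]. *)
Section PWI_not_IND.
Context (R : realType).
Let G : probability nat R := geometric_law R.
Let P : probability (nat * nat)%type R := (G \x G)%E.

Let g n : R := 2^-1 ^+ n.+1.

Let B n : set (nat * nat) :=
  ([set n] `*` [set y | (n <= y)%N]) `|` ([set x | (x < n)%N] `*` [set n]).

Let mX (F H : set nat) : measurable (F `*` H).
Proof. exact: measurableX. Qed.

Let mB n : measurable (B n).
Proof. exact: measurableU. Qed.

Let prX (F H : set nat) : pr P (F `*` H) = pr G F * pr G H.
Proof. by rewrite /pr /= product_measure1E// fineM// fin_num_measure. Qed.

Let g_gt0 n : 0 < g n.
Proof. exact: exprn_gt0. Qed.

Let prB n : pr P (B n) = g n.
Proof.
rewrite pr_setU//; last first.
  by apply/seteqP; split => // -[x y] [[/= -> _] [+ _]]; rewrite ltnn.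
rewrite !prX !pr_geometric -/(g n) (_ : [set x | (x < n)%N] = ~` [set y | (n <= y)%N]).
  by rewrite pr_setC//; lra.
by apply/seteqP; split => x /=; rewrite ltnNge => /negP.
Qed.

Let BI i j : (i < j)%N -> B i `&` B j = [set i] `*` [set j].
Proof.
move=> ij; apply/seteqP; split => -[x y]; rewrite /B /=.
  by move=> [[[xi yi]|[xi yi]] [[xj yj]|[xj yj]]]; split; lia.
by move=> [-> ->]; split; [left|right]; split => //; exact: ltnW.
Qed.

Let prBI i j : i != j -> pr P (B i `&` B j) = g i * g j.
Proof.
wlog ij : i j / (i < j)%N => [hw|_].
  by rewrite neq_ltn => /orP[] h; [|rewrite setIC mulrC]; apply: hw => //;
    rewrite neq_ltn h ?orbT.
by rewrite BI// prX !pr_geometric.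
Qed.

Let A n := ~` B n.

Let mA n : measurable (A n).
Proof. exact: measurableC. Qed.

Let prA n : pr P (A n) = 1 - g n.
Proof. by rewrite pr_setC// prB. Qed.

Let prAI i j : i != j -> pr P (A i `&` A j) = (1 - g i) * (1 - g j).
Proof.
move=> ij; have := pr_setID P (mA i) (mB j); rewrite prA.
have := pr_setID P (mB j) (mB i); rewrite prB setIC (prBI ij).
rewrite [A i `&` B j]setIC -/(A i) -/(A j); lra.
Qed.

Let prAII i j k : (i < j)%N -> (j < k)%N ->
  pr P (A i `&` A j `&` A k) = (1 - g i) * (1 - g j) * (1 - g k) + g i * g j * g k.
Proof.
move=> ij jk; have ik := ltn_trans ij jk.
have neq m n : (m < n)%N -> m != n by rewrite neq_ltn => ->.
have := pr_setID P (measurableI _ _ (mA i) (mA j)) (mB k).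
rewrite -/(A k) prAI ?neq//.
have := pr_setID P (mB k) (measurableU _ _ (mB i) (mB j)).
rewrite setCU setIUr pr_setU; [|exact: measurableI|exact: measurableI|]; last first.
  rewrite setIC [B k `&` B i]setIC [B k `&` B j]setIC !BI//.
  by apply/seteqP; split => // -[x y] /= [[-> _] [ij' _]]; rewrite ij' ltnn in ij.
rewrite prB ![B k `&` B _]setIC !prBI ?neq// [B k `&` _]setIC -/(A i) -/(A j).
lra.
Qed.

Lemma PWI_not_IND : ~ cond_implies R PWI IND.
Proof.
move=> /(_ _ _ P A mA) [].
- apply: sum_pr_infty_half => // n; rewrite prA.
  have : 2^-1 ^+ n <= 1 :> R by rewrite exprn_ile1//; lra.
  by rewrite /g exprS; lra.
- exists 0%N => i j _ _ ij.
  by rewrite !prE//; [rewrite prAI// !prA|exact: measurableI].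
move=> N /(_ (N |` (N.+1 |` [fset N.+2]))%fset).
rewrite !big_fsetU1 ?inE/=; [|lia|lia]; rewrite big_seq_fset1.
rewrite (_ : \bigcap_(j in _) A j = A N `&` A N.+1 `&` A N.+2); last first.
  apply/seteqP; split => w.
    by move=> h; split; [split|]; apply: h; rewrite /= !inE eqxx ?orbT.
  by move=> [[h1 h2] h3] j /=; rewrite !inE => /or3P[] /eqP ->.
have mAI : measurable (A N `&` A N.+1 `&` A N.+2).
  by apply: measurableI => //; exact: measurableI.
rewrite !prE// prAII// !prA => h.
have : (1 - g N) * (1 - g N.+1) * (1 - g N.+2) + g N * g N.+1 * g N.+2
  = (1 - g N) * (1 - g N.+1) * (1 - g N.+2).
  apply: EFin_inj; rewrite h -?EFinM ?mulrA// => j.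
  by rewrite !inE => /or3P[] /eqP ->; lia.
have : 0 < g N * g N.+1 * g N.+2 by apply: mulr_gt0; [exact: mulr_gt0|].
move=> + /eqP; rewrite -subr_eq0 addrAC subrr add0r => + /eqP g3.
by rewrite g3 ltxx.
Qed.

End PWI_not_IND.

(** * The diagram of implications *)

Lemma implies_trans (R : realType) C1 C2 C3 : cond_implies R C1 C2 ->
  cond_implies R C2 C3 -> cond_implies R C1 C3.
Proof. by move=> h1 h2 d T P A mA sumA /(h1 d T P A mA sumA); exact: h2. Qed.

Lemma basic_implies (R : realType) C C' :
  basic_implication C C' -> cond_implies R C C'.
Proof.
case=> d T P A mA sumA /=.
- by move=> /(ER_smom2 mA sumA) h; apply/(KS_smom2 mA sumA).
- by move=> /(KS_smom2 mA sumA) h; apply/(ER_smom2 mA sumA).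
- exact: cond_B_IO.
- exact: cond_IO_B.
- exact: cond_IND_PWI.
- exact: cond_PWI_NOP.
- by move=> /(NOP_smom2 mA)[c c0 h]; exact: linear_variance_ER h.
- by move=> /(NOP_smom2 mA)[c c0 h]; exact: linear_variance_D h.
- exact: cond_ER_SUB.
- exact: cond_D_SUB.
- exact: cond_SUB_IO.
Qed.

Lemma derivable_implies (R : realType) C C' :
  derivable_implication C C' -> cond_implies R C C'.
Proof.
elim=> [C1 C2|C1|C1 C2 C3 _ h1 _ h2]; first exact: basic_implies.
  by move=> d T P A.
exact: implies_trans h1 h2.
Qed.

Lemma derivable_step C1 C2 C3 : basic_implication C1 C2 ->
  derivable_implication C2 C3 -> derivable_implication C1 C3.
Proof. by move=> h; apply: rt_trans; exact: rt_step. Qed.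

Lemma derivable_refl C : derivable_implication C C.
Proof. exact: rt_refl. Qed.

Local Ltac derive :=
  solve [eauto 10 using derivable_refl, derivable_step, ER_KS, KS_ER, B_IO,
    IO_B, IND_PWI, PWI_NOP, NOP_ER, NOP_D, ER_SUB, D_SUB, SUB_IO].

(** If [C] implies [C'] but this is not derivable, then one of the five refuted
    implications [X -> Y] satisfies [X -> C] and [C' -> Y] derivably, whence a
    contradiction.  The choice of [X -> Y] is found by search. *)
Lemma implies_derivable (R : realType) C C' :
  cond_implies R C C' -> derivable_implication C C'.
Proof.
have refute C1 C2 X Y : ~ cond_implies R X Y -> derivable_implication X C1 ->
    derivable_implication C2 Y -> ~ cond_implies R C1 C2.
  move=> nXY XC CY CC; apply: nXY.
  exact (implies_trans (derivable_implies XC)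
    (implies_trans CC (derivable_implies CY))).
case: C C' => -[] h; first
  [ derive
  | exfalso; move: h; first
    [ apply (refute _ _ _ _ (@PWI_not_IND R)); derive
    | apply (refute _ _ _ _ (@NOP_not_PWI R)); derive
    | apply (refute _ _ _ _ (@ER_not_D R)); derive
    | apply (refute _ _ _ _ (@D_not_ER R)); derive
    | apply (refute _ _ _ _ (@IO_not_SUB R)); derive ] ].
Qed.

Theorem mainTheorem1 (R : realType) :
  (cond_implies R ER KS /\ cond_implies R KS ER) /\
  (cond_implies R B IO /\ cond_implies R IO B) /\
  (cond_implies R IND PWI /\ cond_implies R PWI NOP /\ cond_implies R NOP ER /\
   cond_implies R NOP D /\ cond_implies R ER SUB /\ cond_implies R D SUB /\
   cond_implies R SUB IO) /\
  (forall C C' : condition, cond_implies R C C' <-> derivable_implication C C') /\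
  (~ cond_implies R PWI IND /\ ~ cond_implies R NOP PWI /\ ~ cond_implies R ER D /\
   ~ cond_implies R D ER /\ ~ cond_implies R IO SUB).
Proof.
split; first by split; apply: basic_implies; constructor.
split; first by split; apply: basic_implies; constructor.
split; first by do !split; apply: basic_implies; constructor.
split; last first.
  by split; [exact: PWI_not_IND|split; [exact: NOP_not_PWI|split;
    [exact: ER_not_D|split; [exact: D_not_ER|exact: IO_not_SUB]]]].
by move=> C C'; split; [exact: implies_derivable|exact: derivable_implies].
Qed.
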